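(* Let $(X,\phi)$ be any calibrated manifold. If a function $f\in C^\infty(X)$ is $\phi$-plurisubharmonic, then the restriction of $f$ to any $\phi$-submanifold $M\subset X$ is subharmonic in the induced metric on $M$. If $\phi$ is integrable, then the converse holds: if $f\in C^\infty(X)$ restricts to a subharmonic function (in the induced metric) on every $\phi$-submanifold of $X$, then $f$ is $\phi$-plurisubharmonic.
   Context: A calibrated manifold $(X,\phi)$ of degree $p\ge 1$ is a smooth riemannian manifold $X$ together with a closed smooth $p$-form $\phi$ (the calibration) such that $\phi(\xi)\le 1$ for every unit simple tangent $p$-vector $\xi$ on $X$. $G_x(\phi)$ denotes the set of unit simple $p$-vectors $\xi=e_1\wedge\cdots\wedge e_p$ ($e_i\in T_xX$ orthonormal) with $\phi(\xi)=1$, and $G(\phi)=\bigcup_x G_x(\phi)$; its elements are called $\phi$-planes and are identified with oriented $p$-dimensional subspaces $\mathrm{span}\,\xi$ of $T_xX$. For $f\in C^\infty(X)$, the $\phi$-Hessian of $f$ is the $p$-form $\mathcal H^\phi(f)(v_1,\dots,v_p)=\sum_{i=1}^p\phi(v_1,\dots,\nabla_{v_i}(\nabla f),\dots,v_p)$ (with $\nabla_{v_i}(\nabla f)$ in the $i$-th slot), $\nabla$ being the Levi-Civita connection. $f$ is $\phi$-plurisubharmonic if $\mathcal H^\phi(f)(\xi)\ge 0$ for all $\xi\in G(\phi)$. A $\phi$-submanifold is an oriented $p$-dimensional submanifold $M\subset X$ (not necessarily closed in $X$) whose oriented unit tangent $p$-vector at each $x\in M$ belongs to $G_x(\phi)$.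 A smooth function on $M$ is subharmonic if its Laplace-Beltrami Laplacian (trace of the Hessian) is $\ge 0$. $\phi$ is integrable if for each $x\in X$ and each $\xi\in G_x(\phi)$ there is a $\phi$-submanifold $M$ through $x$ whose oriented tangent plane at $x$ is $\xi$. *)

(* Defs.v *)
(* Finite-dimensional smooth manifolds, Riemannian metrics
   and differential forms are described by their components in charts.
   Tangent vectors at a point are row vectors of components, so a linear map
   acts by right multiplication; a p-tuple of tangent vectors is a p x n matrix
   whose rows are the vectors. *)
From mathcomp Require Import all_boot all_order all_algebra.
From mathcomp Require Import all_classical all_reals all_analysis.
Import numFieldNormedType.Exports.
Import Order.TTheory GRing.Theory Num.Theory.

Set Implicit Arguments.
Unset Strict Implicit.
Unset Printing Implicit Defensive.

Local Open Scope classical_set_scope.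
Local Open Scope ring_scope.

(** * Calculus on open subsets of R^n *)

(* [Ck k U f] and [smooth_on U f] are meant for open [U]; [f] is total, but
   only its values on [U] matter. *)
Fixpoint Ck (R : realType) (n : nat) (V : normedModType R) (k : nat)
    (U : set 'rV[R]_n) (f : 'rV[R]_n -> V) : Prop :=
  match k with
  | 0 => forall y, U y -> {for y, continuous f}
  | k'.+1 => (forall y, U y -> differentiable f y) /\
             (forall v, Ck k' U (fun y => 'D_v f y))
  end.

Definition smooth_on (R : realType) (n : nat) (V : normedModType R)
    (U : set 'rV[R]_n) (f : 'rV[R]_n -> V) : Prop :=
  forall k, Ck k U f.

Definition basis_vec (R : realType) (n : nat) (i : 'I_n) : 'rV[R]_n :=
  delta_mx 0 i.

Definition inner (R : realType) (n : nat) (G : 'M[R]_n) (v w : 'rV[R]_n) : R :=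
  (v *m G *m w^T) 0 0.

(* Gamma^k_ij of the Levi-Civita connection of [g], at [y]: the Koszul formula
   for the coordinate vector fields. *)
Definition christoffel (R : realType) (n : nat) (g : 'rV[R]_n -> 'M[R]_n)
    (y : 'rV[R]_n) (i j k : 'I_n) : R :=
  2%:R^-1 * \sum_(l < n) invmx (g y) k l *
    ('D_(basis_vec R i) (fun z => g z j l) y
     + 'D_(basis_vec R j) (fun z => g z i l) y
     - 'D_(basis_vec R l) (fun z => g z i j) y).

(* nabla_v Y at [y], for the Levi-Civita connection of [g]. *)
Definition covariant_derivative (R : realType) (n : nat)
    (g : 'rV[R]_n -> 'M[R]_n) (v : 'rV[R]_n) (Y : 'rV[R]_n -> 'rV[R]_n)
    (y : 'rV[R]_n) : 'rV[R]_n :=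
  'D_v Y y +
  \row_(k < n) \sum_(i < n) \sum_(j < n)
     christoffel g y i j k * v 0 i * Y y 0 j.

Definition gradient (R : realType) (n : nat) (g : 'rV[R]_n -> 'M[R]_n)
    (f : 'rV[R]_n -> R) (y : 'rV[R]_n) : 'rV[R]_n :=
  \row_(k < n) \sum_(l < n) invmx (g y) k l * 'D_(basis_vec R l) f y.

Definition hessian (R : realType) (n : nat) (g : 'rV[R]_n -> 'M[R]_n)
    (f : 'rV[R]_n -> R) (y : 'rV[R]_n) : 'M[R]_n :=
  \matrix_(i < n, j < n)
    inner (g y) (covariant_derivative g (basis_vec R i) (gradient g f) y)
      (basis_vec R j).

(* The trace of the Hessian with respect to the metric. *)
Definition laplacian (R : realType) (n : nat) (g : 'rV[R]_n -> 'M[R]_n)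
    (f : 'rV[R]_n -> R) (y : 'rV[R]_n) : R :=
  \tr (invmx (g y) *m hessian g f y).

(** * Exterior algebra of R^n *)

Definition multilinear (R : realType) (p n : nat)
    (w : 'M[R]_(p, n) -> R) : Prop :=
  forall (i : 'I_p) (A B C : 'M[R]_(p, n)) (b c : R),
    row i A = b *: row i B + c *: row i C ->
    row' i B = row' i A -> row' i C = row' i A ->
    w A = b * w B + c * w C.

Definition alternating (R : realType) (p n : nat)
    (w : 'M[R]_(p, n) -> R) : Prop :=
  forall (i j : 'I_p) (A : 'M[R]_(p, n)),
    i != j -> row i A = row j A -> w A = 0.

(* The simple p-vector E_0 /\ ... /\ E_(p-1), by its (Pluecker) components
   along the e_(I 0) /\ ... /\ e_(I (p-1)); two simple p-vectors are equal iff
   all these components are. *)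
Definition wedge (R : realType) (p n : nat) (E : 'M[R]_(p, n)) :
    ('I_p -> 'I_n) -> R :=
  fun I => \det (colsub I E).

Definition orthonormal_frame (R : realType) (p n : nat) (G : 'M[R]_n)
    (E : 'M[R]_(p, n)) : Prop :=
  E *m G *m E^T = 1%:M.

(* The norm of E_0 /\ ... /\ E_(p-1), i.e. the square root of the Gram
   determinant. *)
Definition wedge_norm (R : realType) (p n : nat) (G : 'M[R]_n)
    (E : 'M[R]_(p, n)) : R :=
  Num.sqrt (\det (E *m G *m E^T)).

(* (d w)(V_0, ..., V_p) at [y], by the invariant formula for constant vector
   fields (for which the bracket terms vanish). *)
Definition exterior_derivative (R : realType) (p n : nat)
    (w : 'rV[R]_n -> 'M[R]_(p, n) -> R) (y : 'rV[R]_n)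
    (V : 'M[R]_(p.+1, n)) : R :=
  \sum_(i < p.+1) (-1) ^+ i * 'D_(row i V) (fun z => w z (row' i V)) y.

Definition replace_row (R : realType) (p n : nat) (E : 'M[R]_(p, n))
    (i : 'I_p) (v : 'rV[R]_n) : 'M[R]_(p, n) :=
  \matrix_(k < p) (if k == i then v else row k E).

(** * Manifolds *)

Record chart (R : realType) (n : nat) (X : topologicalType) := Chart {
  chart_dom : set X;
  chart_map :> X -> 'rV[R]_n;
  chart_inv : 'rV[R]_n -> X;
  chart_dom_open : open chart_dom;
  chart_img_open : open (chart_map @` chart_dom);
  chart_mapK : forall x, chart_dom x -> chart_inv (chart_map x) = x;
  chart_map_continuous : {within chart_dom, continuous chart_map};
  chart_inv_continuous :
    {within chart_map @` chart_dom, continuous chart_inv} }.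

(* A map [h] between manifolds read in the charts [a] and [b]. *)
Definition local_rep (R : realType) (m n : nat) (X Y : topologicalType)
    (a : chart R m X) (b : chart R n Y) (h : X -> Y) : 'rV[R]_m -> 'rV[R]_n :=
  fun y => b (h (chart_inv a y)).

(* The differential of [h] at [x], in components. *)
Definition diff_in (R : realType) (m n : nat) (X Y : topologicalType)
    (a : chart R m X) (b : chart R n Y) (h : X -> Y) (x : X) : 'M[R]_(m, n) :=
  jacobian (local_rep a b h) (a x).

Definition smooth_in (R : realType) (m n : nat) (X Y : topologicalType)
    (a : chart R m X) (b : chart R n Y) (h : X -> Y) : Prop :=
  smooth_on (a @` (chart_dom a `&` h @^-1` chart_dom b)) (local_rep a b h).

Record smooth_atlas (R : realType) (n : nat) (X : topologicalType) := Atlas {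
  charts :> chart R n X -> Prop;
  charts_cover : forall x, exists2 c, charts c & chart_dom c x;
  charts_compatible :
    forall c d, charts c -> charts d -> smooth_in c d idfun }.

Definition chart_at (R : realType) (n : nat) (X : topologicalType)
    (A : smooth_atlas R n X) (x : X) : chart R n X :=
  s2val (cid2 (charts_cover A x)).

Definition oriented (R : realType) (n : nat) (X : topologicalType)
    (A : smooth_atlas R n X) : Prop :=
  forall c d x, A c -> A d -> chart_dom c x -> chart_dom d x ->
    0 < \det (diff_in c d idfun x).

Definition smooth_function (R : realType) (n : nat) (X : topologicalType)
    (A : smooth_atlas R n X) (f : X -> R) : Prop :=
  forall c, A c -> smooth_on (c @` chart_dom c) (f \o chart_inv c).

(* [g c x] is the Gram matrix at [x] of the coordinate frame of the chart [c];
   it is relevant only for [c] in the atlas and [x] in the domain of [c]. *)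
Definition metric_field (R : realType) (n : nat) (X : topologicalType) :=
  chart R n X -> X -> 'M[R]_n.

Definition metric_in (R : realType) (n : nat) (X : topologicalType)
    (g : metric_field R n X) (c : chart R n X) : 'rV[R]_n -> 'M[R]_n :=
  fun y => g c (chart_inv c y).

Record is_riemannian (R : realType) (n : nat) (X : topologicalType)
    (A : smooth_atlas R n X) (g : metric_field R n X) : Prop := {
  metric_smooth :
    forall c, A c -> smooth_on (c @` chart_dom c) (metric_in g c);
  metric_sym : forall c x, A c -> chart_dom c x -> (g c x)^T = g c x;
  metric_posdef : forall c x, A c -> chart_dom c x ->
    forall v, v != 0 -> 0 < inner (g c x) v v;
  metric_change : forall c d x, A c -> A d -> chart_dom c x -> chart_dom d x ->
    g c x = diff_in c d idfun x *m g d x *m (diff_in c d idfun x)^T }.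

(* [phi c x E] is the value of a p-form at [x] on the p tangent vectors whose
   components in the chart [c] are the rows of [E]. *)
Definition form_field (R : realType) (n p : nat) (X : topologicalType) :=
  chart R n X -> X -> 'M[R]_(p, n) -> R.

Definition form_in (R : realType) (n p : nat) (X : topologicalType)
    (phi : form_field R n p X) (c : chart R n X) :
    'rV[R]_n -> 'M[R]_(p, n) -> R :=
  fun y => phi c (chart_inv c y).

Record is_smooth_form (R : realType) (n p : nat) (X : topologicalType)
    (A : smooth_atlas R n X) (phi : form_field R n p X) : Prop := {
  form_smooth : forall c E, A c ->
    smooth_on (c @` chart_dom c) (fun y => form_in phi c y E);
  form_multilinear :
    forall c x, A c -> chart_dom c x -> multilinear (phi c x);
  form_alternating :
    forall c x, A c -> chart_dom c x -> alternating (phi c x);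
  form_change : forall c d x, A c -> A d -> chart_dom c x -> chart_dom d x ->
    forall E, phi c x E = phi d x (E *m diff_in c d idfun x) }.

Definition closed_form (R : realType) (n p : nat) (X : topologicalType)
    (A : smooth_atlas R n X) (phi : form_field R n p X) : Prop :=
  forall c x, A c -> chart_dom c x ->
    forall V, exterior_derivative (form_in phi c) (c x) V = 0.

Definition subharmonic (R : realType) (n : nat) (X : topologicalType)
    (A : smooth_atlas R n X) (g : metric_field R n X) (f : X -> R) : Prop :=
  forall c x, A c -> chart_dom c x ->
    0 <= laplacian (metric_in g c) (f \o chart_inv c) (c x).

(** * Calibrated geometry *)

Record calibrated_manifold (R : realType) (n p : nat) := CalibratedManifold {
  space :> topologicalType;
  space_hausdorff : hausdorff_space space;
  space_second_countable : @second_countable space;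
  atlas : smooth_atlas R n space;
  metric : metric_field R n space;
  metric_riemannian : is_riemannian atlas metric;
  calibration : form_field R n p space;
  calibration_smooth : is_smooth_form atlas calibration;
  calibration_closed : closed_form atlas calibration;
  calibration_le1 : forall c x E, atlas c -> chart_dom c x ->
    orthonormal_frame (metric c x) E -> calibration c x E <= 1 }.
Arguments metric {R n p} X _ _ : rename.
Arguments calibration {R n p} X _ _ _ : rename.

(* [E] is an orthonormal frame of a phi-plane at [x]. *)
Definition phi_frame (R : realType) (n p : nat) (X : calibrated_manifold R n p)
    (c : chart R n X) (x : X) (E : 'M[R]_(p, n)) : Prop :=
  orthonormal_frame (metric X c x) E /\ calibration X c x E = 1.

(* G_x(phi), in components in the chart [c]. *)
Definition phi_planes (R : realType) (n p : nat)
    (X : calibrated_manifold R n p) (c : chart R n X) (x : X) :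
    set (('I_p -> 'I_n) -> R) :=
  @wedge R p n @` [set E | phi_frame c x E].

Definition phi_hessian (R : realType) (n p : nat)
    (X : calibrated_manifold R n p) (f : X -> R) (c : chart R n X) (x : X)
    (E : 'M[R]_(p, n)) : R :=
  let g := metric_in (metric X) c in
  \sum_(i < p) calibration X c x
    (replace_row E i
       (covariant_derivative g (row i E) (gradient g (f \o chart_inv c)) (c x))).

(* The value of the form [phi_hessian] on a simple p-vector is its value on any
   frame representing that p-vector. *)
Definition phi_plurisubharmonic (R : realType) (n p : nat)
    (X : calibrated_manifold R n p) (f : X -> R) : Prop :=
  forall c x E, atlas X c -> chart_dom c x ->
    phi_frame c x E -> 0 <= phi_hessian f c x E.

(* An oriented embedded p-dimensional submanifold: a subset with the subspace
   topology (the topology of its coercion to a type), and an oriented smooth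
   atlas for which the inclusion is a smooth immersion. *)
Record oriented_submanifold (R : realType) (n p : nat)
    (X : calibrated_manifold R n p) := OrientedSubmanifold {
  sub_set :> set X;
  sub_atlas : smooth_atlas R p sub_set;
  sub_oriented : oriented sub_atlas;
  sub_smooth : forall a c, sub_atlas a -> atlas X c ->
    smooth_in a c (fun m : sub_set => set_val m);
  sub_immersion : forall a c m, sub_atlas a -> atlas X c ->
    chart_dom a m -> chart_dom c (set_val m) ->
    row_free (diff_in a c (fun m : sub_set => set_val m) m) }.

(* Rows: the coordinate frame of the chart [a] of [M] at [m], in components in
   the chart [c] of [X]. *)
Definition tangent_frame (R : realType) (n p : nat)
    (X : calibrated_manifold R n p) (M : oriented_submanifold X)
    (a : chart R p M) (c : chart R n X) (m : M) : 'M[R]_(p, n) :=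
  diff_in a c (fun m : M => set_val m) m.

Definition unit_tangent (R : realType) (n p : nat)
    (X : calibrated_manifold R n p) (M : oriented_submanifold X)
    (a : chart R p M) (c : chart R n X) (m : M) : ('I_p -> 'I_n) -> R :=
  let T := tangent_frame a c m in
  fun I => (wedge_norm (metric X c (set_val m)) T)^-1 * wedge T I.

(* The chart of [X] used at a point does not matter, by [metric_change]. *)
Definition induced_metric (R : realType) (n p : nat)
    (X : calibrated_manifold R n p) (M : oriented_submanifold X) :
    metric_field R p M :=
  fun a m =>
    let c := chart_at (atlas X) (set_val m) in
    let T := tangent_frame a c m in
    T *m metric X c (set_val m) *m T^T.

Definition phi_submanifold (R : realType) (n p : nat)
    (X : calibrated_manifold R n p) (M : oriented_submanifold X) : Prop :=
  forall a c (m : M), sub_atlas M a -> atlas X c ->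
    chart_dom a m -> chart_dom c (set_val m) ->
    phi_planes c (set_val m) (unit_tangent a c m).

Definition subharmonic_on (R : realType) (n p : nat)
    (X : calibrated_manifold R n p) (M : oriented_submanifold X)
    (f : X -> R) : Prop :=
  subharmonic (sub_atlas M) (@induced_metric R n p X M)
    (fun m : M => f (set_val m)).

Definition integrable_calibration (R : realType) (n p : nat)
    (X : calibrated_manifold R n p) : Prop :=
  forall c x xi, atlas X c -> chart_dom c x -> phi_planes c x xi ->
    exists (M : oriented_submanifold X) (a : chart R p M) (m : M),
      [/\ phi_submanifold M, sub_atlas M a, chart_dom a m,
          set_val m = x & unit_tangent a c m = xi].

(* Main.v *)
Require Import Defs.
From mathcomp Require Import all_boot all_order all_algebra.
From mathcomp Require Import all_fingroup.
From mathcomp Require Import all_classical all_reals all_analysis.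
From mathcomp Require Import ring lra.
Import numFieldNormedType.Exports.
Import Order.TTheory GRing.Theory Num.Theory.

(** Everything rests on one identity.  Let [M] be a phi-submanifold, [x] a point
    of [M] and [E] an orthonormal frame of the tangent plane of [M] at [x].  Then
    the Laplacian of the restriction of [f] to [M], at [x], equals the phi-Hessian
    of [f] on [E] ([laplacian_phi_hessian]).  If [f] is phi-plurisubharmonic, the
    right-hand side is nonnegative at every point of every [M]; if phi is
    integrable, every phi-plane is tangent to some [M], and the identity is read
    from right to left.

    The identity is local.  Let [F] parametrize [M], let [T] be its coordinate
    frame, [W] the value of phi on [T], [Y] the gradient of [f] on [X] and [h] the
    metric induced on [M].  For every frame [T] at every point of [X], the square
    of the value of phi on [T] is at most the Gram determinant of [T]
    ([calibration_sqr_le]), with equality along [M].  Hence the first derivatives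
    of the two sides agree along [M].
    Varying the frame gives the first cousin principle ([first_cousin]): [W] times
    the [j]-th component of the gradient of the restriction is the value of phi on
    [T] with the [j]-th vector replaced by [Y] ([gradient_calibration]).
    Varying the base point shows that phi is parallel to first order on the frame
    [T]: its derivative in a direction [v] is obtained by letting the connection
    act on the vectors of [T] ([calibration_derivative]).

    Now [W] times the Laplacian is the divergence of [W] times the gradient, hence
    the divergence of those values of phi.  The product rule produces three kinds
    of terms.  Second derivatives of [F] cancel, because they are symmetric and phi
    is alternating.  Derivatives of the coefficients of phi add up, because phi is
    closed, to the derivative of phi in the direction [Y], which becomes a
    connection term.  The derivatives of [Y] complete it to the covariant
    derivative of [Y], and the sum is the phi-Hessian of [f] on [T]
    ([flux_divergence], [laplacian_calibration]).  Passing from [T] to [E]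
    multiplies both sides by the volume of [T].

    The classical detour through the minimality of phi-submanifolds is replaced
    by the two first-order consequences of the calibration inequality. *)

Set Implicit Arguments.
Unset Strict Implicit.
Unset Printing Implicit Defensive.

Local Open Scope classical_set_scope.
Local Open Scope ring_scope.

(** * Multilinear alternating forms on frames *)

Section multilinear_algebra.
Context (R : realType) (p n : nat).
Implicit Types (w : 'M[R]_(p, n) -> R) (A E : 'M[R]_(p, n)) (u v : 'rV[R]_n).

Lemma replace_rowE A i v k j :
  replace_row A i v k j = if k == i then v 0 j else A k j.
Proof. by rewrite !mxE; case: ifP => // _; rewrite mxE. Qed.

Lemma row_replace_row A i v k :
  row k (replace_row A i v) = if k == i then v else row k A.
Proof.
by apply/rowP => j; rewrite mxE replace_rowE; case: ifP => // _; rewrite mxE.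
Qed.

Lemma replace_row_id A i : replace_row A i (row i A) = A.
Proof.
by apply/matrixP => k j; rewrite replace_rowE; case: eqP => // ->; rewrite mxE.
Qed.

Lemma replace_rowC A i k u v : i != k ->
  replace_row (replace_row A i u) k v = replace_row (replace_row A k v) i u.
Proof.
move=> ik; apply/matrixP => l j; rewrite !replace_rowE.
by case: (eqVneq l k) => // ->; rewrite eq_sym (negPf ik).
Qed.

Lemma replace_rowK A i u v :
  replace_row (replace_row A i u) i v = replace_row A i v.
Proof. by apply/matrixP => l j; rewrite !replace_rowE; case: (l == i). Qed.

Lemma row'_replace_row A i v : row' i (replace_row A i v) = row' i A.
Proof.
apply/matrixP => k j; have /negPf ik := neq_lift i k.
by rewrite mxE replace_rowE eq_sym ik mxE.
Qed.

Lemma multilinear_comb w i A b c u v : multilinear w ->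
  w (replace_row A i (b *: u + c *: v)) =
  b * w (replace_row A i u) + c * w (replace_row A i v).
Proof.
move=> wl; apply: (wl i); rewrite ?row'_replace_row //.
by rewrite !row_replace_row eqxx.
Qed.

Lemma multilinear0 w i A : multilinear w -> w (replace_row A i 0) = 0.
Proof.
move=> wl; have := multilinear_comb i A 0 0 0 0 wl.
by rewrite !scale0r addr0 !mul0r addr0.
Qed.

Lemma multilinearD w i A u v : multilinear w ->
  w (replace_row A i (u + v)) = w (replace_row A i u) + w (replace_row A i v).
Proof.
by move=> wl; have := multilinear_comb i A 1 1 u v wl; rewrite !scale1r !mul1r.
Qed.

Lemma multilinearZ w i A b u : multilinear w ->
  w (replace_row A i (b *: u)) = b * w (replace_row A i u).
Proof.
move=> wl; have := multilinear_comb i A b 0 u 0 wl.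
by rewrite scale0r addr0 mul0r addr0.
Qed.

Lemma multilinear_sum w i A (K : finType) (b : K -> R) (u : K -> 'rV[R]_n) :
  multilinear w ->
  w (replace_row A i (\sum_k b k *: u k)) =
  \sum_k b k * w (replace_row A i (u k)).
Proof.
move=> wl; elim/big_ind2 : _ => [|x a y b' <- <-|k _].
- exact: multilinear0.
- exact: multilinearD.
- exact: multilinearZ.
Qed.

Definition basis_tuple (I : 'I_p -> 'I_n) : 'M[R]_(p, n) :=
  \matrix_(i < p, j < n) (j == I i)%:R.

(** By induction on [k], the two functions agree on the matrices whose rows of
    index at least [k] are basis vectors: expanding row [k] in the basis leads
    from [k.+1] back to [k]. *)
Lemma eq_multilinear w1 w2 : multilinear w1 -> multilinear w2 ->
  (forall I, w1 (basis_tuple I) = w2 (basis_tuple I)) -> w1 =1 w2.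
Proof.
move=> m1 m2 w12.
suff H k : forall A, (forall i : 'I_p, (k <= i)%N ->
    exists j, row i A = delta_mx 0 j) -> w1 A = w2 A.
  by move=> A; apply: (H p) => i; rewrite leqNgt ltn_ord.
elim: k => [A Ab|k IH A Ab].
  have /choice[I AI] : forall i : 'I_p, exists j, row i A = delta_mx 0 j.
    by move=> i; exact: Ab.
  suff -> : A = basis_tuple I by [].
  apply/matrixP => i j; have /rowP/(_ j) := AI i.
  by rewrite !mxE eqxx.
have [kp|pk] := ltnP k p; last first.
  apply: IH => i ki; apply: Ab.
  by have := leq_trans (ltn_ord i) pk; rewrite ltnNge ki.
pose i0 := Ordinal kp.
rewrite -(replace_row_id A i0) (row_sum_delta (row i0 A)).
rewrite !multilinear_sum //; apply: eq_bigr => j _; congr (_ * _).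
apply: IH => i ki; rewrite row_replace_row; case: eqP => [_|/eqP ii0].
  by exists j.
by apply: Ab; rewrite ltn_neqAle ki andbT; apply: contra ii0 => /eqP H;
  apply/eqP/val_inj.
Qed.

Lemma multilinear_expansion w A : multilinear w ->
  w A = \sum_(I : {ffun 'I_p -> 'I_n}) (\prod_i A i (I i)) * w (basis_tuple I).
Proof.
move=> wl; move: A; apply: eq_multilinear => //.
  move=> i A B C b c ABC BA CA; rewrite !big_distrr -big_split /=.
  apply: eq_bigr => I _; rewrite !mulrA -mulrDl; congr (_ * _).
  have E D : row' i D = row' i A ->
      \prod_(k | k != i) D k (I k) = \prod_(k | k != i) A k (I k).
    move=> DA; apply: eq_bigr => k; rewrite eq_sym => ik.
    have [l ->] := unlift_some ik.
    by move=> _; have /matrixP/(_ l (I (lift i l))) := DA; rewrite !mxE.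
  rewrite (bigD1 i)//= (bigD1 i (F := fun k => B k _))//=.
  rewrite (bigD1 i (F := fun k => C k _))//= !E // !mulrA -mulrDl.
  by congr (_ * _); have /rowP/(_ (I i)) := ABC; rewrite !mxE.
move=> J; rewrite (bigD1 (finfun J))//= [X in _ + X]big1 => [|I IJ].
  rewrite addr0 big1 => [|i _]; last by rewrite mxE ffunE eqxx.
  by rewrite mul1r; congr w; apply/matrixP => i j; rewrite !mxE ffunE.
have [i iIJ] : exists i, I i != J i.
  apply/existsP; rewrite -negb_forall; apply: contra IJ => /forallP IJ.
  by apply/eqP/ffunP => i; rewrite ffunE; apply/eqP.
by rewrite (bigD1 i)//= mxE (negPf iIJ) !mul0r.
Qed.

Section alternating_forms.
Variable w : 'M[R]_(p, n) -> R.
Hypotheses (wl : multilinear w) (wa : Defs.alternating w).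

(** Polarization of the vanishing of [w] on frames with two equal rows. *)
Lemma alternating_swap A i j u v : i != j ->
  w (replace_row (replace_row A i u) j v) =
  - w (replace_row (replace_row A i v) j u).
Proof.
move=> ij.
have Z x : w (replace_row (replace_row A i x) j x) = 0.
  apply: (wa ij); rewrite !row_replace_row !eqxx (negPf ij).
  by [].
have L y : w (replace_row (replace_row A i (u + v)) j y) =
    w (replace_row (replace_row A i u) j y) +
    w (replace_row (replace_row A i v) j y).
  by rewrite !(replace_rowC _ _ _ ij) multilinearD.
have := Z (u + v); rewrite multilinearD // !L !Z add0r addr0 => /eqP.
by rewrite addrC addr_eq0 => /eqP.
Qed.

Lemma alternating_row_perm (s : 'S_p) A : w (row_perm s A) = (-1) ^+ s * w A.
Proof.
have [ts -> /=] := prod_tpermP s.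
elim: ts => [|[i j] ts IH] /=; first by rewrite big_nil row_perm1 odd_perm1 mul1r.
case/andP => /= ij tsd; rewrite big_cons row_permM odd_mul_tperm ij /=.
rewrite signrN mulNr -(IH tsd) -[in RHS](replace_row_id (row_perm _ A) i).
set B := row_perm _ A.
rewrite -[in RHS](replace_row_id (replace_row _ _ _) j) row_replace_row.
rewrite eq_sym (negPf ij) -alternating_swap; last by [].
congr w; apply/matrixP => k l; rewrite mxE !replace_rowE.
case: tpermP => [->|->|/eqP ki /eqP kj].
- by rewrite eqxx (negPf ij) [RHS]mxE.
- by rewrite eqxx [RHS]mxE.
- by rewrite (negPf ki) (negPf kj).
Qed.

(** Averaging the expansion of [w] over all row permutations turns its
    monomials into minors.  Hence a multilinear alternating function depends on
    a frame only through the simple p-vector that the frame represents, which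
    is how values on coordinate frames and on orthonormal frames are compared
    below. *)
Lemma alternating_wedge A :
  (p`!)%:R * w A = \sum_(I : {ffun 'I_p -> 'I_n}) wedge A I * w (basis_tuple I).
Proof.
transitivity (\sum_(s : 'S_p) (-1) ^+ s * w (row_perm s A)).
  rewrite (eq_bigr (fun=> w A)) => [|s _].
    by rewrite sumr_const cardE -cardT card_Sn mulr_natl.
  by rewrite alternating_row_perm mulrA -signr_addb addbb mul1r.
under eq_bigr do rewrite multilinear_expansion // big_distrr /=.
rewrite exchange_big; apply: eq_bigr => I _ /=.
under eq_bigr do rewrite mulrA; rewrite -big_distrl; congr (_ * _).
rewrite /wedge -det_tr; apply: eq_bigr => s _; congr (_ * _).
by apply: eq_bigr => i _; rewrite !mxE.
Qed.

Lemma wedge_scale A E (a : R) : wedge A = (fun I => a * wedge E I) ->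
  w A = a * w E.
Proof.
move=> AE; have p0 : (p`!)%:R != 0 :> R by rewrite pnatr_eq0 -lt0n fact_gt0.
apply: (mulfI p0); rewrite mulrCA !alternating_wedge big_distrr /=.
by apply: eq_bigr => I _; rewrite AE mulrA.
Qed.

Lemma alternating_mulmx (P : 'M[R]_p) E : w (P *m E) = \det P * w E.
Proof.
apply: wedge_scale; apply/funext => I; rewrite /wedge -det_mulmx; congr (\det _).
by apply/matrixP => i j; rewrite !mxE; apply: eq_bigr => k _; rewrite !mxE.
Qed.

End alternating_forms.

End multilinear_algebra.

(** * Directional derivatives and their symmetry *)

Section directional_derivatives.
Context (R : realType) (V W : normedModType R).
Implicit Types (x v : V).

Lemma is_derive_big_sum (K : finType) (h : K -> V -> W) (dh : K -> W) x v :
  (forall k, is_derive x v (h k) (dh k)) ->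
  is_derive x v (fun y => \sum_k h k y) (\sum_k dh k).
Proof.
move=> hd; rewrite -fct_sumE.
by elim/big_ind2 : _ => // [|*]; [exact: is_derive_cst|exact: is_deriveD].
Qed.

Lemma is_derive_mul (f g : V -> R) (df dg : R) x v :
  is_derive x v f df -> is_derive x v g dg ->
  is_derive x v (fun y => f y * g y) (df * g x + f x * dg).
Proof.
move=> fd gd; apply: is_derive_eq (is_deriveM fd gd) _.
by rewrite addrC /GRing.scale /= (mulrC df).
Qed.

Lemma is_derive_mull (a : R) (f : V -> R) (df : R) x v :
  is_derive x v f df -> is_derive x v (fun y => a * f y) (a * df).
Proof. by move=> fd; apply: is_derive_eq (is_deriveZ a fd) _. Qed.

Lemma is_derive_prod m (a : 'I_m -> V -> R) (da : 'I_m -> R) x v :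
  (forall i, is_derive x v (a i) (da i)) ->
  is_derive x v (fun y => \prod_i a i y)
    (\sum_i \prod_k (if k == i then da k else a k x)).
Proof.
elim: m a da => [|m IH] a da ad.
  rewrite big_ord0 (_ : (fun _ => _) = cst 1); first exact: is_derive_cst.
  by apply/funext => y; rewrite big_ord0.
rewrite (_ : (fun _ => _) =
    (fun y => a ord0 y * \prod_i a (lift ord0 i) y)); last first.
  by apply/funext => y; rewrite big_ord_recl.
have := is_derive_mul (ad ord0) (IH _ _ (fun i => ad (lift ord0 i))).
move/is_derive_eq; apply; rewrite [RHS]big_ord_recl; congr (_ + _).
  by rewrite [RHS]big_ord_recl eqxx.
rewrite big_distrr /=; apply: eq_bigr => i _; rewrite [RHS]big_ord_recl.
by congr (_ * _); apply: eq_bigr => k _; rewrite (inj_eq lift_inj).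
Qed.

Lemma is_derive_unique (f : V -> W) x v a b :
  is_derive x v f a -> is_derive x v f b -> a = b.
Proof. by move=> [_ <-] [_ <-]. Qed.

(** Only a derivative at the point [x] itself is required: the difference
    quotients have opposite signs on the two sides. *)
Lemma is_derive_min (f : V -> R) (d : R) x v :
  is_derive x v f d -> (\forall z \near x, f x <= f z) -> d = 0.
Proof.
move=> [fd dE] fmin.
set q := fun h : R => h^-1 *: (f (h *: v + x) - f x).
have qd : q h @[h --> 0^'] --> d by rewrite -dE; exact: fd.
have fmin0 : \forall h \near (0 : R), f x <= f (h *: v + x).
  have line0 : (fun h : R => h *: v + x) @ 0 --> x.
    rewrite -[X in _ --> X](add0r x) -[X in X + x](scale0r v).
    by apply: cvgD; [exact: cvgZr_tmp cvg_id|exact: cvg_cst].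
  exact: line0 _ fmin.
apply/eqP; rewrite eq_le; apply/andP; split.
  apply: (cvgr_to_le (cvg_dnbhs_at_left qd)).
  near=> h; rewrite /q /GRing.scale /= mulr_le0_ge0 //.
    by rewrite invr_le0 ltW//; near: h; exact: nbhs_left_lt.
  by rewrite subr_ge0; near: h; apply: cvg_within.
apply: (cvgr_to_ge (cvg_dnbhs_at_right qd)).
near=> h; rewrite /q /GRing.scale /= mulr_ge0 //.
  by rewrite invr_ge0 ltW//; near: h; exact: nbhs_right_gt.
by rewrite subr_ge0; near: h; apply: cvg_within.
Unshelve. all: by end_near. Qed.

Lemma is_derive_line (f : V -> W) x v (s : R) d :
  is_derive (s *: v + x) v f d ->
  is_derive s 1 (fun h : R => f (h *: v + x)) d.
Proof.
move=> [fd <-].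
have E : (fun h : R => h^-1 *: (f ((h *: 1 + s) *: v + x) - f (s *: v + x))) =
    (fun h => h^-1 *: (f (h *: v + (s *: v + x)) - f (s *: v + x))).
  by apply/funext => h; rewrite [h *: 1]mulr1 scalerDl addrA.
by split; [rewrite /derivable E|rewrite /derive E].
Qed.

End directional_derivatives.

Lemma is_derive_chain (R : realType) (V W U : normedModType R) (F : V -> W)
    (K : W -> U) (x v : V) : differentiable F x -> differentiable K (F x) ->
  is_derive x v (fun y => K (F y)) ('D_('D_v F x) K (F x)).
Proof.
move=> dF dK; split; first exact/diff_derivable/differentiable_comp.
rewrite [LHS]deriveE; last exact: differentiable_comp.
by rewrite diff_comp // !deriveE.
Qed.

Section multilinear_derivative.
Context (R : realType) (p n : nat) (V : normedModType R).

(** The product rule for a form with variable coefficients evaluated on a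
    moving frame.  The sum over [i] is the derivation that reappears in the
    definition of the phi-Hessian; for [w] the determinant this is the Jacobi
    formula. *)
Lemma is_derive_multilinear (w : V -> 'M[R]_(p, n) -> R)
    (dw : 'M[R]_(p, n) -> R) (A : V -> 'M[R]_(p, n)) (dA : 'M[R]_(p, n)) x v :
  (\forall y \near x, multilinear (w y)) ->
  (forall E, is_derive x v (w^~ E) (dw E)) ->
  (forall i j, is_derive x v (fun y => A y i j) (dA i j)) ->
  is_derive x v (fun y => w y (A y))
    (dw (A x) + \sum_i w x (replace_row (A x) i (row i dA))).
Proof.
move=> wl wd Ad; have wlx := nbhs_singleton wl.
have dwE : dw (A x) = \sum_(I : {ffun 'I_p -> 'I_n})
    (\prod_i A x i (I i)) * dw (basis_tuple R I).
  apply: is_derive_unique (wd _) _.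
  apply: (@near_eq_is_derive _ _ _ (fun y => \sum_(I : {ffun 'I_p -> 'I_n})
    (\prod_i A x i (I i)) * w y (basis_tuple R I))).
    by near do rewrite -multilinear_expansion //.
  by apply: is_derive_big_sum => I; exact: is_derive_mull.
apply: (@near_eq_is_derive _ _ _ (fun y => \sum_(I : {ffun 'I_p -> 'I_n})
    (\prod_i A y i (I i)) * w y (basis_tuple R I))).
  by near do rewrite -multilinear_expansion //.
have H (I : {ffun 'I_p -> 'I_n}) :=
  is_derive_mul (is_derive_prod (fun i => Ad i (I i))) (wd (basis_tuple R I)).
apply: is_derive_eq (is_derive_big_sum H) _.
rewrite big_split /= addrC dwE; congr (_ + _).
under eq_bigr do rewrite big_distrl /=.
rewrite exchange_big /=; apply: eq_bigr => i _.
rewrite (multilinear_expansion _ wlx); apply: eq_bigr => I _; congr (_ * _).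
apply: eq_bigr => k _; rewrite replace_rowE.
by case: eqP => // ->; rewrite mxE.
Unshelve. all: by end_near. Qed.

End multilinear_derivative.

Lemma is_derive_det (R : realType) (p : nat) (V : normedModType R)
    (A : V -> 'M[R]_p) (dA : 'M[R]_p) x v :
  (forall i j, is_derive x v (fun y => A y i j) (dA i j)) ->
  is_derive x v (fun y => \det (A y)) (\tr (\adj (A x) *m dA)).
Proof.
move=> Ad.
have detl : multilinear (determinant : 'M[R]_p -> R).
  by move=> i A' B C b c; exact: determinant_multilinear.
have detlx : \forall y \near x, multilinear ((fun _ : V => @determinant R p) y).
  exact: nearW.
have := is_derive_multilinear detlx (fun E => is_derive_cst _ _ _) Ad.
move/is_derive_eq; apply; rewrite add0r /mxtrace.
under [RHS]eq_bigr do rewrite mxE.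
rewrite [RHS]exchange_big /=; apply: eq_bigr => i _.
rewrite (expand_det_row _ i); apply: eq_bigr => j _.
rewrite replace_rowE eqxx !mxE mulrC; congr (_ * _).
congr (_ * \det _); apply/matrixP => k l.
by have /negPf ik := neq_lift i k; rewrite 2![LHS]mxE replace_rowE eq_sym ik !mxE.
Qed.

Section symmetry_of_second_derivatives.
Context (R : realType) (V : normedModType R).
Implicit Types (f a b c d : V -> R) (v w y : V).

(** The mean value theorem in direction [v], then in direction [w], writes the
    second difference as [t ^+ 2] times a value of [c] at a point of the
    parallelogram, which is close to [c y] by continuity. *)
Lemma second_difference f a c v w y :
  (\forall z \near y, is_derive z v f (a z)) ->
  (\forall z \near y, is_derive z w a (c z)) ->
  {for y, continuous c} ->
  forall e : R, 0 < e -> exists2 r : R, 0 < r & forall t, 0 < t < r ->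
    `|f (t *: v + (t *: w + y)) - f (t *: v + y)
      - (f (t *: w + y) - f y) - t * (t * c y)| <= e * t ^+ 2.
Proof.
move=> fa ac cy e e0.
have /nbhs_normP[r /= r0 yr] : \forall z \near y,
    [/\ is_derive z v f (a z), is_derive z w a (c z) & `|c y - c z| <= e].
  near=> z; split; first by near: z.
    by near: z.
  by near: z; move/cvgrPdist_le : cy; exact.
have vw0 : 0 < `|v| + `|w| + 1 by rewrite ltr_wpDl// addr_ge0.
exists (r / (`|v| + `|w| + 1)); first by rewrite divr_gt0.
move=> t /andP[t0]; rewrite ltr_pdivlMr // => tr.
have near_y s q : 0 <= s <= t -> 0 <= q <= t ->
    let z := s *: v + (q *: w + y) in
    [/\ is_derive z v f (a z), is_derive z w a (c z) & `|c y - c z| <= e].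
  move=> /andP[s0 st] /andP[q0 qt]; apply: yr; rewrite /= distrC addrA addrK.
  apply: le_lt_trans tr; apply: le_trans (ler_normD _ _) _.
  rewrite !normrZ !ger0_norm // !mulrDr mulr1 -addrA lerD ?ler_wpM2r //.
  by rewrite -[leLHS]addr0 lerD ?ler_wpM2r // ltW.
have t0t : 0 <= t <= t by rewrite (ltW t0) /=.
have z0t : 0 <= (0 : R) <= t by rewrite (ltW t0) andbT.
have itv s : s \in `[0, t]%R -> 0 <= s <= t by rewrite in_itv.
pose phi s := f (s *: v + (t *: w + y)) - f (s *: v + y).
have phid s : s \in `[0, t]%R ->
    is_derive s 1 phi (a (s *: v + (t *: w + y)) - a (s *: v + y)).
  move=> /itv st; have [f1 _ _] := near_y s t st t0t.
  have [f2 _ _] := near_y s 0 st z0t; rewrite scale0r add0r in f2.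
  by apply: is_deriveB; exact: is_derive_line.
pose dphi s := a (s *: v + (t *: w + y)) - a (s *: v + y).
have [s st phiE] : exists2 s, s \in `]0, t[%R & phi t - phi 0 = dphi s * (t - 0).
  have H1 s : s \in `]0, t[%R -> is_derive s 1 phi (dphi s).
    by move=> /subset_itv_oo_cc; exact: phid.
  have H2 : {within `[0, t], continuous phi}.
    by apply: derivable_within_continuous => s /phid[].
  exact: MVT t0 H1 H2.
have {}st := itv _ (subset_itv_oo_cc st).
pose psi q := a (q *: w + (s *: v + y)).
have psid q : q \in `[0, t]%R ->
    is_derive q 1 psi (c (q *: w + (s *: v + y))).
  move=> /itv qt; have [_ a1 _] := near_y s q st qt.
  by apply: is_derive_line; rewrite addrCA.
pose dpsi q := c (q *: w + (s *: v + y)).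
have [q qt psiE] : exists2 q, q \in `]0, t[%R & psi t - psi 0 = dpsi q * (t - 0).
  have H1 q : q \in `]0, t[%R -> is_derive q 1 psi (dpsi q).
    by move=> /subset_itv_oo_cc; exact: psid.
  have H2 : {within `[0, t], continuous psi}.
    by apply: derivable_within_continuous => q /psid[].
  exact: MVT t0 H1 H2.
have {}qt := itv _ (subset_itv_oo_cc qt).
have [_ _ cz] := near_y s q st qt.
move: phiE psiE; rewrite /phi /dphi /psi /dpsi !scale0r !add0r !subr0 => ->.
rewrite addrCA => ->; rewrite addrCA.
set z := s *: v + _ in cz *.
rewrite (_ : _ - _ = - (t ^+ 2 * (c y - c z))); last by ring.
rewrite normrN normrM ger0_norm ?exprn_ge0 ?(ltW t0) // [leLHS]mulrC.
by rewrite ler_wpM2r // exprn_ge0 // ltW.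
Unshelve. all: by end_near. Qed.

(** The second difference is symmetric in the two directions, so that both
    mixed derivatives are its limit after division by [t ^+ 2]. *)
Lemma mixed_derivatives f a b c d v w y :
  (\forall z \near y, is_derive z v f (a z)) ->
  (\forall z \near y, is_derive z w a (c z)) ->
  (\forall z \near y, is_derive z w f (b z)) ->
  (\forall z \near y, is_derive z v b (d z)) ->
  {for y, continuous c} -> {for y, continuous d} -> c y = d y.
Proof.
move=> fa ac fb bd cy dy; apply/eqP; rewrite -subr_eq0 -normr_le0.
apply/ler_addgt0Pr => e e0; rewrite add0r.
have e20 : 0 < e / 2 by rewrite divr_gt0.
have [r1 r10 H1] := second_difference fa ac cy e20.
have [r2 r20 H2] := second_difference fb bd dy e20.
(* the factor 1/2 keeps [t] strictly below both radii *)
pose t := Num.min r1 r2 / 2.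
have t0 : 0 < t by rewrite divr_gt0 // lt_min r10.
have tm : t < Num.min r1 r2 by rewrite /t ltr_pdivrMr // ltr_pMr ?lt_min ?r10 // ltr1n.
have t1 : 0 < t < r1 by rewrite t0 (lt_le_trans tm) // ge_min lexx.
have t2 : 0 < t < r2 by rewrite t0 (lt_le_trans tm) // ge_min lexx orbT.
have {}H1 := H1 t t1; have {}H2 := H2 t t2; rewrite (addrCA (t *: w)) in H2.
rewrite -(@ler_pM2l _ (t ^+ 2)) ?exprn_gt0 //.
rewrite -[X in X * `|_|]ger0_norm ?exprn_ge0 ?(ltW t0) // -normrM.
rewrite (_ : _ * (_ - _) = (f (t *: v + (t *: w + y)) - f (t *: w + y)
      - (f (t *: v + y) - f y) - t * (t * d y)) -
    (f (t *: v + (t *: w + y)) - f (t *: v + y)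
      - (f (t *: w + y) - f y) - t * (t * c y))); last by ring.
apply: le_trans (ler_normB _ _) _.
by rewrite (le_trans (lerD H2 H1)) // -mulrDl -splitr mulrC.
Qed.

End symmetry_of_second_derivatives.

(** * Positive definite forms and calibrated frames *)

Section matrix_derivatives.
Context (R : realType) (V : normedModType R).
Implicit Types (x v : V).

Definition is_derive_mx (m n : nat) x v (A : V -> 'M[R]_(m, n))
    (dA : 'M[R]_(m, n)) : Prop :=
  forall i j, is_derive x v (fun y => A y i j) (dA i j).

Lemma is_derive_mx_cst m n x v (A : 'M[R]_(m, n)) :
  is_derive_mx x v (fun=> A) 0.
Proof. by move=> i j; rewrite mxE; exact: is_derive_cst. Qed.

Lemma is_derive_mx_tr m n x v (A : V -> 'M[R]_(m, n)) dA :
  is_derive_mx x v A dA -> is_derive_mx x v (fun y => (A y)^T) dA^T.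
Proof.
move=> Ad i j; rewrite mxE.
rewrite (_ : (fun _ => _) = (fun y => A y j i)); first exact: Ad.
by apply/funext => y; rewrite mxE.
Qed.

Lemma is_derive_mx_mul m n q x v (A : V -> 'M[R]_(m, n))
    (B : V -> 'M[R]_(n, q)) dA dB :
  is_derive_mx x v A dA -> is_derive_mx x v B dB ->
  is_derive_mx x v (fun y => A y *m B y) (dA *m B x + A x *m dB).
Proof.
move=> Ad Bd i j.
rewrite (_ : (fun _ => _) = (fun y => \sum_k A y i k * B y k j)); last first.
  by apply/funext => y; rewrite mxE.
have := is_derive_big_sum (fun k => is_derive_mul (Ad i k) (Bd k j)).
by move/is_derive_eq; apply; rewrite big_split !mxE.
Qed.

Lemma is_derive_gram m n x v (A : V -> 'M[R]_(m, n)) (G : V -> 'M[R]_n) dA dG :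
  is_derive_mx x v A dA -> is_derive_mx x v G dG ->
  is_derive_mx x v (fun y => A y *m G y *m (A y)^T)
    (dA *m G x *m (A x)^T + A x *m dG *m (A x)^T + A x *m G x *m dA^T).
Proof.
move=> Ad Gd.
have := is_derive_mx_mul (is_derive_mx_mul Ad Gd) (is_derive_mx_tr Ad).
by rewrite mulmxDl.
Qed.

End matrix_derivatives.

Section positive_definite_forms.
Context (R : realType).

Definition posdef (m : nat) (G : 'M[R]_m) : Prop :=
  G^T = G /\ forall v, v != 0 -> 0 < inner G v v.

Lemma posdef_gram m n (G : 'M[R]_n) (T : 'M[R]_(m, n)) :
  posdef G -> row_free T -> posdef (T *m G *m T^T).
Proof.
move=> [Gs Gp] Tf; split; first by rewrite !trmx_mul trmxK Gs mulmxA.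
move=> v v0; have := Gp (v *m T); rewrite /inner trmx_mul !mulmxA; apply.
apply: contra v0 => /eqP vT; apply/eqP/(row_free_inj Tf).
by rewrite /= vT mul0mx.
Qed.

(** Induction on the size: clearing the first row and column leaves the Schur
    complement [c - a^-1 *: (b *m b^T)], which is again positive definite. *)
Lemma cholesky m (h : 'M[R]_m) : posdef h ->
  exists2 P : 'M[R]_m, h = P *m P^T & 0 < \det P.
Proof.
elim: m h => [|m IH] h [hs hp].
  by exists 1%:M; [apply/matrixP => -[]|rewrite det1].
move: h hs hp; rewrite -[m.+1]/(1 + m)%N => h hs hp.
pose a := h 0 0; pose b := dlsubmx h; pose c := drsubmx h.
have hE : h = block_mx a%:M b^T b c.
  rewrite -[LHS](@submxK R 1 m 1 m); congr block_mx.
    by apply/matrixP => i j; rewrite !ord1 !mxE eqxx mulr1n; congr (h _ _);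
      apply/val_inj.
  by rewrite /b trmx_dlsub hs.
have cs : c^T = c by rewrite /c trmx_drsub hs.
have a0 : 0 < a.
  have := hp (delta_mx 0 0); rewrite /inner -rowE trmx_delta -colE !mxE; apply.
  by apply/eqP => /matrixP/(_ 0 0) /eqP; rewrite !mxE eqxx oner_eq0.
pose c' := c - a^-1 *: (b *m b^T).
have [|P' c'E P'0] := IH c'.
  split; first by rewrite /c' linearB linearZ /= trmx_mul trmxK cs.
  move=> v v0; pose t := (v *m b) 0 0.
  have vb : v *m b = t%:M by rewrite [LHS]mx11_scalar.
  have bv : b^T *m v^T = t%:M by rewrite -trmx_mul vb tr_scalar_mx.
  (* this vector is orthogonal for [h] to the first basis vector *)
  have := hp (row_mx (- (a^-1 * t))%:M v); rewrite hE /inner.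
  rewrite mul_row_block tr_row_mx mul_row_col tr_scalar_mx vb.
  rewrite -scalar_mxM -raddfD /= mulNr mulrAC mulVf ?gt_eqF // mul1r addNr.
  rewrite mul_scalar_mx scale0r add0r mulmxDl -mulmxA bv -scalar_mxM.
  rewrite mulmxBr mulmxBl -scalemxAr -scalemxAl -!mulmxA bv !mulmxA vb.
  rewrite -scalar_mxM scale_scalar_mx ![in X in _ -> X]mxE ![in X in X -> _]mxE.
  rewrite mulNr mulrA addrC; apply; apply: contra v0.
  by rewrite row_mx_eq0 => /andP[].
have s0 : 0 < Num.sqrt a by rewrite sqrtr_gt0.
have sE : Num.sqrt a * Num.sqrt a = a by rewrite -expr2 sqr_sqrtr // ltW.
exists (block_mx (Num.sqrt a)%:M 0 ((Num.sqrt a)^-1 *: b) P').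
  rewrite tr_block_mx mulmx_block hE; congr block_mx.
  - by rewrite tr_scalar_mx -scalar_mxM sE trmx0 mulmx0 addr0.
  - by rewrite linearZ /= mul_scalar_mx scalerA mulfV ?gt_eqF // scale1r mul0mx addr0.
  - rewrite tr_scalar_mx mul_mx_scalar scalerA mulfV ?gt_eqF // scale1r.
    by rewrite trmx0 mulmx0 addr0.
  - rewrite -c'E linearZ /= -scalemxAl -scalemxAr scalerA -invfM sE.
    by rewrite /c' addrC subrK.
by rewrite det_lblock det_scalar expr1 mulr_gt0.
Qed.

Lemma posdef_det_gt0 m (h : 'M[R]_m) : posdef h -> 0 < \det h.
Proof.
by case/cholesky => P -> P0; rewrite det_mulmx det_tr -expr2 exprn_gt0.
Qed.

Lemma posdef_unit m (h : 'M[R]_m) : posdef h -> h \in unitmx.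
Proof. by move=> /posdef_det_gt0 h0; rewrite unitmxE unitfE gt_eqF. Qed.

Lemma adj_invmx m (h : 'M[R]_m) : h \in unitmx -> \adj h = \det h *: invmx h.
Proof.
move=> hu; rewrite /invmx hu scalerA mulfV ?scale1r //.
by rewrite -unitfE -unitmxE.
Qed.

Lemma orthonormal_factor m n (G : 'M[R]_n) (T : 'M[R]_(m, n)) :
  posdef G -> row_free T ->
  exists (P : 'M[R]_m) (E : 'M[R]_(m, n)),
    [/\ T = P *m E, orthonormal_frame G E & T *m G *m T^T = P *m P^T].
Proof.
move=> Gp Tf; have [P hE P0] := cholesky (posdef_gram Gp Tf).
have Pu : P \in unitmx by rewrite unitmxE unitfE gt_eqF.
exists P, (invmx P *m T); split => //; first by rewrite mulKVmx.
rewrite /orthonormal_frame trmx_mul !mulmxA -[_ *m T *m G]mulmxA.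
rewrite -[_ *m (T *m G) *m _]mulmxA hE mulKmx // -trmx_mul.
by rewrite mulVmx // trmx1.
Qed.

(** The calibration inequality for arbitrary frames, squared.  A free frame is
    [P *m E] with [E] orthonormal, which multiplies both [w] and the square root
    of the Gram determinant by [\det P].  Squaring makes both sides polynomial in
    the frame, hence differentiable also at degenerate frames; the bound
    [- w E <= 1] comes from reversing one vector of the frame, which is where
    [p] has to be positive. *)
Lemma calibration_sqr_le (p n : nat) (G : 'M[R]_n) (w : 'M[R]_(p, n) -> R) :
  (0 < p)%N -> posdef G -> multilinear w -> Defs.alternating w ->
  (forall E, orthonormal_frame G E -> w E <= 1) ->
  forall T, w T ^+ 2 <= \det (T *m G *m T^T).
Proof.
move=> p0 Gp wl wa w1 T; have [Tf|] := boolP (row_free T); last first.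
  rewrite -kermx_eq0 => /rowV0Pn[v /sub_kermxP vT v0].
  have [i vi] : exists i, v 0 i != 0.
    apply/existsP; rewrite -negb_forall; apply: contra v0 => /forallP v0.
    by apply/eqP/rowP => i; rewrite mxE; exact/eqP/v0.
  have -> : w T = 0.
    have := @multilinear_sum _ _ _ w i T _ (fun k => v 0 k) (fun k => row k T) wl.
    rewrite -mulmx_sum_row vT multilinear0 // (bigD1 i) //= replace_row_id big1.
      by move/esym/eqP; rewrite addr0 mulf_eq0 (negPf vi) => /eqP.
    move=> k ki; rewrite (wa k i) ?mulr0 //.
    by rewrite !row_replace_row eqxx (negPf ki).
  suff -> : \det (T *m G *m T^T) = 0 by rewrite expr0n.
  by apply/eqP/det0P; exists v; rewrite // !mulmxA vT !mul0mx.
have [P [E [-> Eo hE]]] := orthonormal_factor Gp Tf.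
(* the reflection that reverses the vector of index 0 *)
pose D := diag_mx (\row_(i < p) ((-1) ^+ (i == Ordinal p0)) : 'rV[R]_p).
have DD : D *m D = 1%:M.
  rewrite /D mulmx_diag -diag_const_mx; congr diag_mx.
  by apply/rowP => i; rewrite !mxE -expr2 sqrr_sign.
have detD : \det D = -1.
  rewrite det_diag (bigD1 (Ordinal p0)) //= mxE eqxx big1 ?mulr1 ?expr1 //.
  by move=> i /negPf i0; rewrite mxE i0.
have wE1 : w E <= 1 by exact: w1.
have wEN1 : - w E <= 1.
  rewrite -mulN1r -detD -alternating_mulmx //; apply: w1.
  rewrite /orthonormal_frame trmx_mul tr_diag_mx !mulmxA -[_ *m E *m G]mulmxA.
  by rewrite -[_ *m (E *m G) *m _]mulmxA Eo mulmx1 DD.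
rewrite alternating_mulmx // hE det_mulmx det_tr -expr2 exprMn.
rewrite ler_piMr ?sqr_ge0 // -subr_ge0.
rewrite (_ : _ - _ = (1 - w E) * (1 + w E)); last by ring.
by rewrite mulr_ge0 // ?subr_ge0 // -[w E]opprK subr_ge0.
Qed.

(** The difference [\det (T *m G *m T^T) - w T ^+ 2] is nonnegative and vanishes
    at a calibrated frame, so its derivative there is zero.  Replacing one
    vector of the frame by [v] thus only sees the component of [v] in the plane
    of the frame (the first cousin principle). *)
Lemma first_cousin (p n : nat) (G : 'M[R]_n) (w : 'M[R]_(p, n) -> R)
    (T : 'M[R]_(p, n)) :
  G^T = G -> multilinear w ->
  (forall T, w T ^+ 2 <= \det (T *m G *m T^T)) ->
  w T ^+ 2 = \det (T *m G *m T^T) ->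
  forall i v, w T * w (replace_row T i v) =
    (\adj (T *m G *m T^T) *m (T *m G *m v^T)) i 0.
Proof.
move=> Gs wl wle wT i v.
set h := T *m G *m T^T in wT *.
have hs : h^T = h by rewrite /h !trmx_mul trmxK Gs mulmxA.
pose A (t : R) := replace_row T i (row i T + t *: v).
pose dA : 'M[R]_(p, n) := replace_row 0 i v.
have A0 : A 0 = T by rewrite /A scale0r addr0 replace_row_id.
have Ad : is_derive_mx (0 : R) 1 A dA.
  move=> k j; rewrite replace_rowE.
  rewrite (_ : (fun _ => _) = if k == i then (fun t => T i j + t * v 0 j)
    else (fun=> T k j)); last first.
    by apply/funext => t; rewrite replace_rowE; case: ifP => _; rewrite ?mxE.
  case: ifP => _; last by rewrite mxE; exact: is_derive_cst.
  have := is_deriveD (is_derive_cst (T i j) (0 : R) 1)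
    (is_derive_mul (is_derive_id (0 : R) 1) (is_derive_cst (v 0 j) (0 : R) 1)).
  by move/is_derive_eq; apply; rewrite mulr0 addr0 mul1r add0r.
have detd := is_derive_det (is_derive_gram Ad (is_derive_mx_cst (0 : R) 1 G)).
have wlx : \forall t \near (0 : R), multilinear ((fun=> w) t).
  exact: (@nearW R (nbhs (0 : R))) (fun=> wl).
have wd := is_derive_multilinear wlx (fun E => is_derive_cst (w E) (0 : R) 1) Ad.
have /(_ _)/eqP := is_derive_min (is_deriveB detd (is_derive_mul wd wd)).
rewrite /= !A0 -/h add0r mulmx0 mul0mx addr0.
have -> : \sum_k w (replace_row T k (row k dA)) = w (replace_row T i v).
  rewrite (bigD1 i) //= row_replace_row eqxx big1 ?addr0 // => k /negPf ki.
  by rewrite row_replace_row ki row0 multilinear0.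
(* only the row [i] of [dA] is nonzero, so the trace reduces to one entry *)
have trE : \tr (\adj h *m (T *m G *m dA^T)) = (\adj h *m (T *m G *m v^T)) i 0.
  rewrite !mulmxA; set M := _ *m G; rewrite mxE /mxtrace (bigD1 i) //= big1.
    rewrite addr0 mxE; apply: eq_bigr => j _.
    by rewrite ![_^T _ _]mxE replace_rowE eqxx.
  move=> k /negPf ki; rewrite mxE big1 // => j _.
  by rewrite [_^T _ _]mxE replace_rowE ki [X in _ * X]mxE mulr0.
rewrite mulmxDr linearD /= trE -[\tr (_ *m (dA *m _ *m _))]mxtrace_tr.
rewrite !trmx_mul trmxK Gs trmx_adj hs mxtrace_mulC [T *m (_ *m _)]mulmxA trE.
set a := (_ *m _) i 0 => H.
suff : a + a - (w (replace_row T i v) * w T + w T * w (replace_row T i v)) == 0.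
  by move/eqP; lra.
apply: H; apply: (@nearW R (nbhs (0 : R))) => t.
change (\det (A 0 *m G *m (A 0)^T) - w (A 0) * w (A 0)
  <= \det (A t *m G *m (A t)^T) - w (A t) * w (A t)).
by rewrite A0 -/h -!expr2 wT subrr subr_ge0.
Qed.

End positive_definite_forms.

(** * Differentiability of matrix expressions and closed forms *)

Section differentiability.
Context (R : realType) (V : normedModType R).
Implicit Types (W : normedModType R) (x : V).

Lemma near_differentiable W (f g : V -> W) x :
  {near x, f =1 g} -> differentiable f x -> differentiable g x.
Proof.
move=> fg /diff_locallyP[dc fo]; have fgx := nbhs_singleton fg.
have go : g \o shift x = cst (g x) + 'd f x +o_ 0 id.
  apply/eqaddoP => e e0; have /eqaddoP/(_ _ e0) := fo.
  have : \forall h \near (0 : V), f (h + x) = g (h + x).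
    have shift0 : shift x @ 0 --> x.
      by rewrite -[X in _ --> X]add0r; apply: cvgD; [exact: cvg_id|exact: cvg_cst].
    exact: shift0 _ fg.
  apply: filterS2 => h fgh.
  rewrite (_ : (f \o shift x - (cst (f x) + 'd f x)) h =
    (g \o shift x - (cst (g x) + 'd f x)) h) //.
  by rewrite !fctE /= fgh fgx.
by apply/diff_locallyP; rewrite (diff_unique dc go).
Qed.

Lemma differentiable_big_sum W (K : finType) (f : K -> V -> W) x :
  (forall k, differentiable (f k) x) ->
  differentiable (fun y => \sum_k f k y) x.
Proof.
move=> fd; rewrite -fct_sumE; elim/big_ind : _ => [|*|//]; first exact: differentiable_cst.
exact: differentiableD.
Qed.

Lemma differentiable_big_prod (K : finType) (f : K -> V -> R) x :
  (forall k, differentiable (f k) x) ->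
  differentiable (fun y => \prod_k f k y) x.
Proof.
move=> fd; rewrite -fct_prodE; elim/big_ind : _ => [|*|//]; first exact: differentiable_cst.
exact: differentiableM.
Qed.

Lemma differentiable_entry m n (A : V -> 'M[R]_(m, n)) x i j :
  differentiable A x -> differentiable (fun y => A y i j) x.
Proof.
move=> Ad; apply: (differentiable_comp (g := fun N : 'M[R]_(m, n) => N i j)) => //.
exact: differentiable_coord.
Qed.

Lemma differentiable_row n (f : 'I_n -> V -> R) x :
  (forall k, differentiable (f k) x) -> differentiable (fun y => \row_k f k y) x.
Proof.
move=> fd.
rewrite (_ : (fun _ => _) = fun y => \sum_k f k y *: delta_mx 0 k); last first.
  apply/funext => y; rewrite [LHS]row_sum_delta.
  by apply: eq_bigr => k _; rewrite mxE.
rewrite -fct_sumE; elim/big_ind : _ => [|*|k _]; first exact: differentiable_cst.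
  exact: differentiableD.
exact: differentiableZl.
Qed.

Lemma differentiable_det m (A : V -> 'M[R]_m) x :
  (forall i j, differentiable (fun y => A y i j) x) ->
  differentiable (fun y => \det (A y)) x.
Proof.
move=> Ad; apply: (@differentiable_big_sum R _
  (fun (s : 'S_m) y => (-1) ^+ s * \prod_i A y i (s i))) => s.
apply: (differentiableM (f := fun=> _)); first exact: differentiable_cst.
by apply: differentiable_big_prod.
Qed.

Lemma differentiable_invmx m (A : V -> 'M[R]_m) x :
  (\forall y \near x, A y \in unitmx) -> differentiable A x ->
  forall i j, differentiable (fun y => invmx (A y) i j) x.
Proof.
move=> Au Ad i j; have Aux := nbhs_singleton Au.
apply: (@near_differentiable _ (fun y => (\det (A y))^-1 * \adj (A y) i j)).
  by near=> y; rewrite /invmx ifT ?mxE //; near: y.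
have Ae k l := differentiable_entry k l Ad.
apply: (differentiableM (f := fun y => (\det (A y))^-1)).
  apply: differentiableV; first exact: differentiable_det.
  by rewrite -unitfE -unitmxE.
rewrite (_ : (fun _ => _) =
    fun y => (-1) ^+ (j + i) * \det (row' j (col' i (A y)))); last first.
  by apply/funext => y; rewrite mxE.
apply: (differentiableM (f := fun=> _)); first exact: differentiable_cst.
apply: differentiable_det => k l.
rewrite (_ : (fun _ => _) = fun y => A y (lift j k) (lift i l)) //.
by apply/funext => y; rewrite !mxE.
Unshelve. all: by end_near. Qed.

Lemma continuous_entry m n (A : V -> 'M[R]_(m, n)) x i j :
  {for x, continuous A} -> {for x, continuous (fun y => A y i j)}.
Proof.
move=> Ac; apply: (@continuous_comp _ _ _ A (fun M : 'M[R]_(m, n) => M i j) x Ac).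
exact: coord_continuous.
Qed.

Lemma derive_entry m n (A : V -> 'M[R]_(m, n)) x v i j :
  derivable A x v -> is_derive x v (fun y => A y i j) ('D_v A x i j).
Proof.
move=> Ad; split; first by move/derivable_mxP : Ad => /(_ i j).
by rewrite derive_mx // mxE.
Qed.

End differentiability.

Lemma derive_sum_basis (R : realType) (n : nat) (W : normedModType R)
    (f : 'rV[R]_n -> W) x v : differentiable f x ->
  'D_v f x = \sum_i v 0 i *: 'D_(basis_vec R i) f x.
Proof.
move=> fd; rewrite deriveE // [v in LHS]row_sum_delta linear_sum /=.
by apply: eq_bigr => i _; rewrite linearZ /= -deriveE.
Qed.

Section exterior_derivative.
Context (R : realType) (p n : nat).

(** Moving the vector [v] from the front of the frame to its place [j] is a
    cycle of length [j.+1], hence the sign. *)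
Lemma row'_prepend_row (T : 'M[R]_(p, n)) (v : 'rV[R]_n)
    (w : 'M[R]_(p, n) -> R) (j : 'I_p) :
  multilinear w -> Defs.alternating w ->
  let V := \matrix_(i < p.+1) (if unlift ord0 i is Some k then row k T else v) in
  w (row' (lift ord0 j) V) = (-1) ^+ j * w (replace_row T j v).
Proof.
case: p T w j => [|q] T w j wl wa /=; first by case: j.
rewrite -[(-1) ^+ j](signr_odd R).
(* the cycle is the lift of the identity that sends index 0 to [j] *)
have -> : odd j = lift_perm ord0 j 1 :> bool.
  by rewrite odd_lift_perm odd_perm1 addbF.
rewrite -alternating_row_perm //; congr w; apply/matrixP => k l.
rewrite [LHS]mxE [LHS]mxE [RHS]mxE replace_rowE.
case: (unliftP ord0 k) => [k' ->|->]; last first.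
  rewrite lift_perm_id eqxx (_ : lift _ _ = ord0) ?unlift_none //.
  exact: val_inj.
rewrite lift_perm_lift perm1 eq_sym (negPf (neq_lift _ _)).
rewrite (_ : lift _ _ = lift ord0 (lift j k')) ?liftK ?mxE //.
by apply: val_inj; rewrite /= /bump !add1n ltnS addnS.
Qed.

(** With the signs absorbed by reordering the frames, closedness says that the
    derivative of a form in a direction [v] is the divergence, along the frame,
    of its contractions with [v]. *)
Lemma exterior_derivative0 (w : 'rV[R]_n -> 'M[R]_(p, n) -> R) z T v :
  (\forall y \near z, multilinear (w y)) ->
  (\forall y \near z, Defs.alternating (w y)) ->
  (forall E u, derivable (w^~ E) z u) ->
  (forall V, exterior_derivative w z V = 0) ->
  'D_v (w^~ T) z = \sum_j 'D_(row j T) (w^~ (replace_row T j v)) z.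
Proof.
move=> wl wa wd dw0.
set V : 'M[R]_(p.+1, n) :=
  \matrix_(i < p.+1) (if unlift ord0 i is Some k then row k T else v).
have := dw0 V; rewrite /exterior_derivative big_ord_recl expr0 mul1r.
rewrite rowK unlift_none (_ : (fun y => w y (row' ord0 V)) = w^~ T); last first.
  apply/funext => y; congr (w y); apply/matrixP => k l.
  by rewrite !mxE liftK mxE.
move/eqP; rewrite addr_eq0 => /eqP ->; rewrite -sumrN; apply: eq_bigr => j _.
rewrite rowK liftK.
rewrite (near_eq_derive (g := (-1) ^+ j \*: w^~ (replace_row T j v))); last first.
  by near=> y; rewrite row'_prepend_row //; near: y.
rewrite deriveZ // /GRing.scale /= /bump add1n exprS mulN1r mulNr opprK mulrA.
by rewrite -expr2 sqrr_sign mul1r.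
Unshelve. all: by end_near. Qed.

End exterior_derivative.

(** * The Levi-Civita connection in a chart *)

Section riemannian_geometry.
Context (R : realType) (n : nat) (g : 'rV[R]_n -> 'M[R]_n).
Implicit Types (z v : 'rV[R]_n).

(** The endomorphism sending a tangent vector [t] to the covariant derivative
    along [t] of the constant vector field [v]. *)
Definition connection_mx z v : 'M[R]_n :=
  \matrix_(j < n, k < n) \sum_(i < n) christoffel g z i j k * v 0 i.

Definition partials (u : 'rV[R]_n -> R) z : 'cV[R]_n :=
  \col_l 'D_(basis_vec R l) u z.

Lemma gradientE u z : gradient g u z = (invmx (g z) *m partials u z)^T.
Proof.
by apply/rowP => k; rewrite !mxE; apply: eq_bigr => l _; rewrite mxE.
Qed.

Lemma christoffel_sym z i j k :
  (\forall y \near z, (g y)^T = g y) ->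
  christoffel g z i j k = christoffel g z j i k.
Proof.
move=> gs; congr (_ * _); apply: eq_bigr => l _; congr (_ * _).
rewrite [X in X - _]addrC.
congr (_ - _); apply: near_eq_derive.
by apply: filterS gs => y gsy; rewrite -[in LHS]gsy mxE.
Qed.

Lemma christoffel_lower z i a b :
  (g z)^T = g z -> g z \in unitmx ->
  \sum_k christoffel g z i a k * g z k b =
  2^-1 * ('D_(basis_vec R i) (fun y => g y a b) z
     + 'D_(basis_vec R a) (fun y => g y i b) z
     - 'D_(basis_vec R b) (fun y => g y i a) z).
Proof.
move=> gs gu; rewrite /christoffel.
pose D l := 'D_(basis_vec R i) (fun y => g y a l) z
     + 'D_(basis_vec R a) (fun y => g y i l) z
     - 'D_(basis_vec R l) (fun y => g y i a) z.
transitivity (\sum_l 2^-1 * D l * (\sum_k g z b k * invmx (g z) k l)).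
  under eq_bigr do rewrite big_distrr big_distrl /=.
  rewrite exchange_big; apply: eq_bigr => l _; rewrite big_distrr /=.
  apply: eq_bigr => k _; rewrite -/(D l).
  by rewrite (_ : g z k b = g z b k); [ring|rewrite -[in LHS]gs mxE].
have gV l : \sum_k g z b k * invmx (g z) k l = (b == l)%:R.
  by have /matrixP/(_ b l) := mulmxV gu; rewrite !mxE.
rewrite (bigD1 b) //= gV eqxx mulr1 big1 ?addr0 // => l lb.
by rewrite gV eq_sym (negPf lb) mulr0.
Qed.

(** The Koszul formula, read backwards: the antisymmetric terms of
    [christoffel_lower] cancel in the symmetrized sum. *)
Lemma metric_compatibility z v :
  (\forall y \near z, (g y)^T = g y) -> g z \in unitmx ->
  differentiable g z ->
  is_derive_mx z v g
    (connection_mx z v *m g z + (connection_mx z v *m g z)^T).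
Proof.
move=> gs gu gd a b; have gsz := nbhs_singleton gs.
have ge k l : differentiable (fun y => g y k l) z by exact: differentiable_entry.
split; first exact: diff_derivable.
rewrite derive_sum_basis // [RHS]mxE [X in _ + X]mxE.
have E c d : (connection_mx z v *m g z) c d = \sum_i v 0 i *
    (2^-1 * ('D_(basis_vec R i) (fun y => g y c d) z
     + 'D_(basis_vec R c) (fun y => g y i d) z
     - 'D_(basis_vec R d) (fun y => g y i c) z)).
  rewrite mxE; under eq_bigr do rewrite mxE big_distrl /=.
  rewrite exchange_big; apply: eq_bigr => i _ /=.
  rewrite -christoffel_lower // big_distrr /=; apply: eq_bigr => k _; ring.
rewrite !E -big_split /=; apply: eq_bigr => i _.
have -> : 'D_(basis_vec R i) (fun y => g y b a) z =
    'D_(basis_vec R i) (fun y => g y a b) z.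
  by apply: near_eq_derive; apply: filterS gs => y gsy; rewrite -[in LHS]gsy mxE.
by rewrite -mulrDr; congr (_ * _); field.
Qed.

Lemma covariant_derivativeE v (Y : 'rV[R]_n -> 'rV[R]_n) z :
  (\forall y \near z, (g y)^T = g y) ->
  covariant_derivative g v Y z = 'D_v Y z + v *m connection_mx z (Y z).
Proof.
move=> gs; congr (_ + _); apply/rowP => k; rewrite !mxE; apply: eq_bigr => i _.
rewrite mxE big_distrr /=; apply: eq_bigr => j _.
by rewrite christoffel_sym //; ring.
Qed.

Lemma gradient_differentiable u z :
  (\forall y \near z, g y \in unitmx) -> differentiable g z ->
  (forall v, differentiable (fun y => 'D_v u y) z) ->
  differentiable (gradient g u) z.
Proof.
move=> gu gd ud; apply: (@differentiable_row _ _ _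
  (fun k y => \sum_l invmx (g y) k l * 'D_(basis_vec R l) u y)) => k.
apply: (@differentiable_big_sum _ _ _ _
  (fun l y => invmx (g y) k l * 'D_(basis_vec R l) u y)) => l.
by apply: differentiableM; [exact: differentiable_invmx|exact: ud].
Qed.

(** The trace of the Hessian is the divergence of the gradient, and the traces
    of the Christoffel symbols are half the logarithmic derivatives of the
    determinant of the metric: the two other terms of the Koszul formula cancel
    in the trace. *)
Lemma laplacianE u z :
  (\forall y \near z, (g y)^T = g y) -> g z \in unitmx ->
  (forall v, derivable (gradient g u) z v) ->
  laplacian g u z = \sum_j
    ('D_(basis_vec R j) (fun y => gradient g u y 0 j) z +
     2^-1 * gradient g u z 0 j *
     \tr (invmx (g z) *m \matrix_(a, b) 'D_(basis_vec R j) (fun y => g y a b) z)).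
Proof.
move=> gs gu Yd; have gsz := nbhs_singleton gs; set Y := gradient g u in Yd *.
pose C := \matrix_i covariant_derivative g (basis_vec R i) Y z.
have -> : laplacian g u z = \tr C.
  rewrite /laplacian (_ : hessian g u z = C *m g z).
    by rewrite mxtrace_mulC mulmxK.
  apply/matrixP => i j; rewrite mxE /inner -/Y /basis_vec trmx_delta -colE !mxE.
  by apply: eq_bigr => k _; rewrite !mxE.
have DYE j : 'D_(basis_vec R j) Y z 0 j =
    'D_(basis_vec R j) (fun y => Y y 0 j) z.
  by rewrite derive_mx // mxE.
have iVs : (invmx (g z))^T = invmx (g z) by rewrite trmx_inv gsz.
rewrite /mxtrace big_split /=.
transitivity (\sum_i ('D_(basis_vec R i) (fun y => Y y 0 i) z +
    \sum_b christoffel g z i b i * Y z 0 b)).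
  apply: eq_bigr => i _; rewrite mxE covariant_derivativeE // mxE DYE.
  congr (_ + _); rewrite -rowE !mxE; apply: eq_bigr => b _.
  by rewrite christoffel_sym.
rewrite big_split /=; congr (_ + _); rewrite exchange_big /=.
apply: eq_bigr => b _.
rewrite -big_distrl /= [RHS]mulrAC; congr (_ * _).
rewrite -big_distrr; congr (_ * _).
set J := invmx (g z) in iVs *.
have JC i l : J i l = J l i by rewrite -[in LHS]iVs mxE.
pose A i l := 'D_(basis_vec R i) (fun y => g y b l) z.
transitivity (\sum_i \sum_l (J i l * 'D_(basis_vec R b) (fun y => g y l i) z +
    (J i l * A i l - J l i * A l i))).
  apply: eq_bigr => i _; apply: eq_bigr => l _; rewrite -(JC i l) /A.
  rewrite (@near_eq_derive _ _ _ (fun y => g y i b) (fun y => g y b i)); last first.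
    by apply: filterS gs => y gsy; rewrite -[in LHS]gsy mxE.
  rewrite (@near_eq_derive _ _ _ (fun y => g y i l) (fun y => g y l i)); last first.
    by apply: filterS gs => y gsy; rewrite -[in LHS]gsy mxE.
  by ring.
transitivity (\sum_i \sum_l J i l * 'D_(basis_vec R b) (fun y => g y l i) z +
    (\sum_i \sum_l J i l * A i l - \sum_i \sum_l J l i * A l i)).
  rewrite -sumrB -big_split; apply: eq_bigr => i _.
  by rewrite -sumrB -big_split.
rewrite [X in _ + (X - _)]exchange_big subrr addr0 /=.
by apply: eq_bigr => i _; rewrite mxE; apply: eq_bigr => l _; rewrite mxE.
Qed.

End riemannian_geometry.

(** * The calibration inequality to first order in the base point *)

Section minimality.
Context (R : realType) (p n : nat).

(** The inequality [w y T ^+ 2 <= \det (T *m g y *m T^T)] holds at all points [y]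
    near [z] and is an equality at [z], so both sides have the same derivative
    there.  Metric compatibility computes the derivative of the Gram determinant
    through the connection, and [first_cousin] turns the result back into values
    of [w].  Along a calibrated submanifold, this takes the place of minimality. *)
Lemma calibration_derivative (g : 'rV[R]_n -> 'M[R]_n)
    (w : 'rV[R]_n -> 'M[R]_(p, n) -> R) (z v : 'rV[R]_n) (T : 'M[R]_(p, n)) :
  (0 < p)%N ->
  (\forall y \near z, [/\ posdef (g y), multilinear (w y),
     Defs.alternating (w y) &
     forall E, orthonormal_frame (g y) E -> w y E <= 1]) ->
  differentiable g z -> derivable (w^~ T) z v ->
  w z T ^+ 2 = \det (T *m g z *m T^T) -> w z T != 0 ->
  'D_v (w^~ T) z =
    \sum_i w z (replace_row T i (row i T *m connection_mx g z v)).
Proof.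
move=> p0 gw gd wd wT w0; have [[gsz gpz] wlz waz w1z] := nbhs_singleton gw.
have gs : \forall y \near z, (g y)^T = g y by apply: filterS gw => y [[]].
have gu : g z \in unitmx by rewrite unitmxE unitfE gt_eqF // posdef_det_gt0.
set N := connection_mx g z v; set h := T *m g z *m T^T in wT.
have hs : h^T = h by rewrite /h !trmx_mul trmxK gsz mulmxA.
have detd := is_derive_det
  (is_derive_gram (is_derive_mx_cst z v T) (metric_compatibility v gs gu gd)).
have wd' := derivableP wd.
have /(_ _)/eqP := is_derive_min (is_deriveB detd (is_derive_mul wd' wd')).
rewrite /= -/h trmx0 mulmx0 !mul0mx add0r addr0 -/N.
have trE : \tr (\adj h *m (T *m (N *m g z)^T *m T^T)) =
    \sum_i w z T * w z (replace_row T i (row i T *m N)).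
  apply: eq_bigr => i _.
  rewrite (first_cousin gsz wlz) //; last exact: calibration_sqr_le.
  rewrite -/h trmx_mul gsz trmx_mul !mulmxA mxE [RHS]mxE.
  by apply: eq_bigr => k _; rewrite ![_^T _ _]mxE [row _ _ _ _]mxE.
rewrite mulmxDr mulmxDl mulmxDr linearD /= trE -[\tr (_ *m (T *m _ *m _))]mxtrace_tr.
rewrite !trmx_mul !trmxK trmx_adj hs mxtrace_mulC [T *m (_ *m _)]mulmxA.
rewrite -trmx_mul trE -big_distrr /=; set S := \sum_i _ => H.
suff : w z T * S + w z T * S -
    ('D_v (w^~ T) z * w z T + w z T * 'D_v (w^~ T) z) == 0.
  by move/eqP=> E; apply: (mulfI w0); lra.
apply: H; apply: filterS gw => y [gy wly way w1y].
change (\det (T *m g z *m T^T) - w z T * w z T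
  <= \det (T *m g y *m T^T) - w y T * w y T).
by rewrite -!expr2 wT subrr subr_ge0 calibration_sqr_le.
Qed.

End minimality.

(** * The Laplacian of a calibrated parametrized submanifold *)

Lemma row_jacobian (R : realType) (m n : nat) (F : 'rV[R]_m -> 'rV[R]_n) y i :
  differentiable F y -> row i (jacobian F y) = 'D_(basis_vec R i) F y.
Proof. by move=> Fd; rewrite deriveEjacobian // rowE. Qed.

Lemma antisymmetric_sum (R : numDomainType) (p : nat) (X : 'I_p -> 'I_p -> R) :
  (forall i j, i != j -> X i j = - X j i) ->
  \sum_j \sum_(i | i != j) X j i = 0.
Proof.
move=> XN; set s := \sum_j _.
suff : s = - s by move/eqP; rewrite -addr_eq0 -mulr2n mulrn_eq0 => /eqP.
rewrite {1}/s (exchange_big_dep predT) //= -sumrN; apply: eq_bigr => i _.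
rewrite -sumrN; apply: eq_big => [j|j]; first by rewrite eq_sym.
by move=> ij; rewrite XN // eq_sym.
Qed.

Section local_identity.
Context (R : realType) (p n : nat) (p0 : (0 < p)%N).
Context (O : set 'rV[R]_n) (S : set 'rV[R]_p) (Oo : open O) (So : open S).
Context (g : 'rV[R]_n -> 'M[R]_n) (w : 'rV[R]_n -> 'M[R]_(p, n) -> R).
Context (u : 'rV[R]_n -> R) (F : 'rV[R]_p -> 'rV[R]_n).
Hypothesis gd : forall z, O z -> differentiable g z.
Hypothesis gp : forall z, O z -> posdef (g z).
Hypothesis wl : forall z, O z -> multilinear (w z).
Hypothesis wa : forall z, O z -> Defs.alternating (w z).
Hypothesis wd : forall z E, O z -> differentiable (w^~ E) z.
Hypothesis w_closed : forall z V, O z -> exterior_derivative w z V = 0.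
Hypothesis w1 : forall z E, O z -> orthonormal_frame (g z) E -> w z E <= 1.
Hypothesis ud : forall z, O z -> differentiable u z.
Hypothesis udd : forall z v, O z -> differentiable (fun y => 'D_v u y) z.
Hypothesis FSO : forall y, S y -> O (F y).
Hypothesis Fd : forall y, S y -> differentiable F y.
Hypothesis Fdd : forall y v, S y -> differentiable (fun x => 'D_v F x) y.
Hypothesis Fc : forall y v v', S y ->
  {for y, continuous (fun x => 'D_v' (fun x => 'D_v F x) x)}.

Let T y := jacobian F y.
Let gram y := T y *m g (F y) *m (T y)^T.
Let W y := w (F y) (T y).

Hypothesis T_free : forall y, S y -> row_free (T y).
Hypothesis W_gram : forall y, S y -> W y ^+ 2 = \det (gram y).

Context (h : 'rV[R]_p -> 'M[R]_p) (q : 'rV[R]_p -> R).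
Hypothesis hE : forall y, S y -> h y = gram y.
Hypothesis qE : forall y, S y -> q y = u (F y).

Let Y := gradient g u.
Let Yh := gradient h q.

Let nearS y : S y -> \forall x \near y, S x.
Proof. by move=> Sy; apply: open_nbhs_nbhs. Qed.

Let nearO z : O z -> \forall x \near z, O x.
Proof. by move=> Oz; apply: open_nbhs_nbhs. Qed.

Lemma gram_posdef y : S y -> posdef (gram y).
Proof. by move=> Sy; apply: posdef_gram; [exact/gp/FSO|exact: T_free]. Qed.

Lemma W_neq0 y : S y -> W y != 0.
Proof.
move=> Sy; rewrite -sqrf_eq0 W_gram // gt_eqF //.
exact/posdef_det_gt0/gram_posdef.
Qed.

Lemma partials_comp y : S y -> partials q y = T y *m partials u (F y).
Proof.
move=> Sy; apply/colP => i; rewrite mxE.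
rewrite (near_eq_derive (g := u \o F)); last first.
  by near=> x; apply: qE; near: x; exact: nearS.
have [_ ->] := is_derive_chain (basis_vec R i) (Fd Sy) (ud (FSO Sy)).
rewrite derive_sum_basis; last exact/ud/FSO.
by rewrite -row_jacobian ?mxE; [apply: eq_bigr => k _; rewrite !mxE|exact: Fd].
Unshelve. all: by end_near. Qed.

(** The function on the right is the flux of the ambient gradient [Y] through
    the [j]-th face of the coordinate frame.  By the first cousin principle the
    normal component of [Y] does not contribute, and the tangential component of
    [Y] is the gradient [Yh] of the restriction. *)
Lemma gradient_calibration y j : S y ->
  W y * Yh y 0 j = w (F y) (replace_row (T y) j (Y (F y))).
Proof.
move=> Sy; have Oz := FSO Sy; have [gs _] := gp Oz.
have gu : g (F y) \in unitmx by exact/posdef_unit/gp.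
apply: (mulfI (W_neq0 Sy)).
rewrite (first_cousin gs (wl Oz)); first last.
- exact: W_gram.
- exact: (calibration_sqr_le p0 (gp Oz) (wl Oz) (wa Oz) (fun E => w1 Oz)).
have -> : T y *m g (F y) *m (Y (F y))^T = partials q y.
  by rewrite /Y gradientE trmxK -mulmxA mulKVmx // partials_comp.
rewrite -/(gram y) mulrA -expr2 W_gram // /Yh gradientE mxE hE //.
rewrite adj_invmx; last exact/posdef_unit/gram_posdef.
by rewrite -scalemxAl [RHS]mxE mxE.
Qed.

Lemma tangent_derivative y v : S y ->
  is_derive_mx y v T (\matrix_(i, k) 'D_v (fun x => 'D_(basis_vec R i) F x) y 0 k).
Proof.
move=> Sy i k; rewrite mxE.
apply: (@near_eq_is_derive _ _ _ (fun x => 'D_(basis_vec R i) F x 0 k)).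
  near=> x; rewrite -row_jacobian ?mxE //; apply: Fd.
  by near: x; exact: nearS.
by apply: derive_entry; apply: diff_derivable; exact: Fdd.
Unshelve. all: by end_near. Qed.

Lemma second_derivatives_sym y i j : S y ->
  'D_(basis_vec R j) (fun x => 'D_(basis_vec R i) F x) y =
  'D_(basis_vec R i) (fun x => 'D_(basis_vec R j) F x) y.
Proof.
move=> Sy; apply/rowP => k.
have D1 a x : S x -> is_derive x a (fun x => F x 0 k) ('D_a F x 0 k).
  by move=> Sx; apply: derive_entry; exact/diff_derivable/Fd.
have D2 a b x : S x -> is_derive x b (fun x => 'D_a F x 0 k)
    ('D_b (fun x => 'D_a F x) x 0 k).
  by move=> Sx; apply: derive_entry; exact/diff_derivable/Fdd.
have cont a b : {for y, continuous (fun x => 'D_b (fun x => 'D_a F x) x 0 k)}.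
  exact: continuous_entry (@Fc y a b Sy).
have nS := nearS Sy.
apply: (mixed_derivatives (f := fun x => F x 0 k) (w := basis_vec R j)
  (v := basis_vec R i) _ _ _ _ (cont _ _) (cont _ _)).
- by apply: filterS nS => x; exact: D1.
- by apply: filterS nS => x; exact: D2.
- by apply: filterS nS => x; exact: D1.
- by apply: filterS nS => x; exact: D2.
Qed.

(** The three terms differentiate the coefficients of [w], the vector field [Y],
    and the other vectors of the coordinate frame. *)
Lemma flux_derivative y v j : S y ->
  is_derive y v
    (fun x => w (F x) (replace_row (T x) j (Y (F x))))
    ('D_('D_v F y) (w^~ (replace_row (T y) j (Y (F y)))) (F y) +
     (w (F y) (replace_row (T y) j ('D_('D_v F y) Y (F y))) +
      \sum_(i | i != j) w (F y) (replace_row (replace_row (T y) j (Y (F y))) i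
         ('D_v (fun x => 'D_(basis_vec R i) F x) y)))).
Proof.
move=> Sy; have Oz := FSO Sy.
pose dT : 'M[R]_(p, n) :=
  \matrix_(i, k) 'D_v (fun x => 'D_(basis_vec R i) F x) y 0 k.
have Yd : differentiable Y (F y).
  apply: gradient_differentiable; [|exact: gd|by move=> a; exact: udd].
  by apply: filterS (nearO Oz) => z Oz'; exact/posdef_unit/gp.
have Ad : is_derive_mx y v (fun x => replace_row (T x) j (Y (F x)))
    (replace_row dT j ('D_('D_v F y) Y (F y))).
  move=> i k; rewrite replace_rowE.
  rewrite (_ : (fun _ => _) = if i == j then (fun x => Y (F x) 0 k)
    else (fun x => T x i k)); last first.
    by apply/funext => x; rewrite replace_rowE; case: ifP.
  case: ifP => _; last exact: tangent_derivative.
  have dYF : differentiable (Y \o F) y by apply: differentiable_comp => //; exact: Fd.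
  have [_ E] := is_derive_chain v (Fd Sy) Yd.
  have := derive_entry 0 k (diff_derivable (v := v) dYF).
  by move/is_derive_eq; apply; rewrite E.
have wFl : \forall x \near y, multilinear (w (F x)).
  by apply: filterS (nearS Sy) => x Sx; exact/wl/FSO.
have wFd E := is_derive_chain v (Fd Sy) (wd E Oz).
apply: is_derive_eq (is_derive_multilinear wFl wFd Ad) _; congr (_ + _).
rewrite (bigD1 j) //= row_replace_row eqxx replace_rowK; congr (_ + _).
apply: eq_bigr => i /negPf ij; rewrite row_replace_row ij.
by congr (w _ (replace_row _ _ _)); apply/rowP => k; rewrite !mxE.
Qed.

(** The second derivatives of the parametrization drop out because they are
    symmetric and [w] is alternating.  Closedness turns the derivatives of the
    coefficients into the derivative of [w] in the direction [Y], which
    [calibration_derivative] rewrites with the connection; the result is the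
    connection part of the covariant derivative of [Y]. *)
Lemma flux_divergence y : S y ->
  \sum_j 'D_(basis_vec R j) (fun x => w (F x) (replace_row (T x) j (Y (F x)))) y =
  \sum_i w (F y) (replace_row (T y) i
    (covariant_derivative g (row i (T y)) Y (F y))).
Proof.
move=> Sy; have Oz := FSO Sy.
have gwz : \forall z \near F y, [/\ posdef (g z), multilinear (w z),
    Defs.alternating (w z) & forall E, orthonormal_frame (g z) E -> w z E <= 1].
  apply: filterS (nearO Oz) => z Oz'.
  by split; [exact: gp|exact: wl|exact: wa|move=> E; exact: w1].
have gs : \forall z \near F y, (g z)^T = g z by apply: filterS gwz => z [[]].
rewrite (eq_bigr _ (fun j _ => @derive_val _ _ _ _ _ _ _
  (flux_derivative (basis_vec R j) j Sy))).
have DF j : 'D_(basis_vec R j) F y = row j (T y).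
  by rewrite row_jacobian //; exact: Fd.
under eq_bigr do rewrite DF.
rewrite !big_split /= antisymmetric_sum => [|i j ij]; last first.
  rewrite [LHS](alternating_swap (wl Oz) (wa Oz) _ _ _ ij) (replace_rowC _ _ _ ij).
  exact: (congr1 (fun a => - w (F y) (replace_row
    (replace_row (T y) j (Y (F y))) i a)) (second_derivatives_sym j i Sy)).
rewrite addr0 -exterior_derivative0; first last.
- by move=> V; exact: w_closed.
- by move=> E v; exact/diff_derivable/wd.
- by apply: filterS gwz => z [].
- by apply: filterS gwz => z [].
rewrite (calibration_derivative p0 gwz); first last.
- exact: W_neq0.
- exact: W_gram.
- exact/diff_derivable/wd.
- exact: gd.
rewrite -big_split; apply: eq_bigr => i _ /=.
rewrite (covariant_derivativeE _ _ gs) (multilinearD _ _ _ _ (wl Oz)).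
exact: addrC.
Qed.

Lemma metric_derivable y v a b : S y -> derivable (fun x => h x a b) y v.
Proof.
move=> Sy; have gFd : differentiable (g \o F) y.
  by apply: differentiable_comp; [exact: Fd|exact/gd/FSO].
have gFm : is_derive_mx y v (g \o F) ('D_v (g \o F) y).
  by move=> c d; apply: derive_entry; exact: diff_derivable.
have [hd _] := is_derive_gram (tangent_derivative v Sy) gFm a b.
apply: near_eq_derivable hd.
by apply: filterS (nearS Sy) => x Sx; rewrite hE.
Qed.

(** The function [W] is the Riemannian volume density up to sign; its derivative
    follows from that of the Gram determinant [W ^+ 2]. *)
Lemma volume_derivative y v : S y ->
  is_derive y v W (2^-1 * W y *
    \tr (invmx (h y) *m \matrix_(a, b) 'D_v (fun x => h x a b) y)).
Proof.
move=> Sy; have Oz := FSO Sy; have W0 := W_neq0 Sy.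
have wFl : \forall x \near y, multilinear (w (F x)).
  by apply: filterS (nearS Sy) => x Sx; exact/wl/FSO.
have Wd := is_derive_multilinear wFl
  (fun E => is_derive_chain v (Fd Sy) (wd E Oz)) (tangent_derivative v Sy).
apply: is_derive_eq (Wd) _; set d := _ + _ in Wd *.
have hd : is_derive_mx y v h (\matrix_(a, b) 'D_v (fun x => h x a b) y).
  by move=> a b; rewrite mxE; apply/derivableP/metric_derivable.
have detd : is_derive y v (fun x => W x * W x)
    (\tr (\adj (h y) *m \matrix_(a, b) 'D_v (fun x => h x a b) y)).
  apply: near_eq_is_derive (is_derive_det hd).
  by apply: filterS (nearS Sy) => x Sx; rewrite -expr2 W_gram // hE.
have := is_derive_unique detd (is_derive_mul Wd Wd).
rewrite adj_invmx; last by rewrite hE //; exact/posdef_unit/gram_posdef.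
rewrite -scalemxAl mxtraceZ [in \det _]hE // -W_gram // -/(W y) => E.
by apply: (mulfI W0); lra.
Qed.

(** The left-hand side is the divergence of [W *: Yh], that is, the divergence
    of the flux. *)
Lemma laplacian_calibration y : S y ->
  W y * laplacian h q y = \sum_i w (F y) (replace_row (T y) i
    (covariant_derivative g (row i (T y)) Y (F y))).
Proof.
move=> Sy; have nS := nearS Sy.
have Yhd j v : derivable (fun x => Yh x 0 j) y v.
  apply: (@near_eq_derivable _ _ _ (fun x => (W x)^-1 *
      w (F x) (replace_row (T x) j (Y (F x))))).
    by apply: filterS nS => x Sx; rewrite -gradient_calibration // mulKf // W_neq0.
  have [Wd _] := volume_derivative v Sy; have [fd _] := flux_derivative v j Sy.
  exact: derivableM (derivableV (W_neq0 Sy) Wd) fd.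
rewrite -flux_divergence // laplacianE; first last.
- move=> v; apply/derivable_mxP => i j; rewrite ord1; exact: Yhd.
- by rewrite hE //; exact/posdef_unit/gram_posdef.
- by apply: filterS nS => x Sx; rewrite hE //; case: (gram_posdef Sx).
rewrite big_distrr /=; apply: eq_bigr => j _.
have WYd := is_derive_mul (volume_derivative (basis_vec R j) Sy)
  (derivableP (Yhd j (basis_vec R j))).
have WYE : \forall x \near y,
    W x * Yh x 0 j = w (F x) (replace_row (T x) j (Y (F x))).
  by apply: filterS nS => x Sx; rewrite gradient_calibration.
by have [_ ->] := near_eq_is_derive WYE WYd; rewrite /Yh; ring.
Qed.

End local_identity.

(** * The derivation of a form, and charts of a submanifold *)

Section derivation_of_forms.
Context (R : realType) (p n : nat) (w : 'M[R]_(p, n) -> R) (L : 'M[R]_n).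

(** The extension of the endomorphism [L] to p-vectors as a derivation, composed
    with [w].  With [L] the covariant differential of the gradient it is the
    phi-Hessian. *)
Definition derivation_form (E : 'M[R]_(p, n)) : R :=
  \sum_i w (replace_row E i (row i E *m L)).

Lemma derivation_form_multilinear : multilinear w -> multilinear derivation_form.
Proof.
move=> wl i A B C b c ABC BA CA.
have rowK' (D : 'M[R]_(p, n)) : row' i D = row' i A -> D = replace_row A i (row i D).
  move=> DA; apply/matrixP => k j; rewrite replace_rowE.
  case: (unliftP i k) => [l ->|->]; last by rewrite eqxx mxE.
  rewrite eq_sym (negPf (neq_lift _ _)).
  by have /matrixP/(_ l j) := DA; rewrite !mxE.
have -> : A = replace_row A i (b *: row i B + c *: row i C).
  by rewrite -ABC replace_row_id.
(* all three frames are now variants of one frame in row [i] *)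
rewrite (rowK' B BA) (rowK' C CA) !row_replace_row eqxx.
rewrite /derivation_form !big_distrr -big_split; apply: eq_bigr => k _ /=.
rewrite !row_replace_row; have [->|ki] := eqVneq k i.
  by rewrite !replace_rowK mulmxDl -!scalemxAl multilinear_comb.
have ik : i != k by rewrite eq_sym.
by rewrite !(replace_rowC _ _ _ ik) multilinear_comb.
Qed.

Lemma derivation_form_alternating :
  multilinear w -> Defs.alternating w -> Defs.alternating derivation_form.
Proof.
move=> wl wa i j A ij Aij; rewrite /derivation_form.
rewrite (bigD1 i) //= (bigD1 j) 1?eq_sym //= big1 => [|k /andP[ki kj]].
  rewrite addr0 -Aij -[X in _ + w (replace_row X _ _)](replace_row_id A i).
  rewrite alternating_swap // (_ : replace_row (replace_row A i _) j _ =
    replace_row A i (row i A *m L)) ?subrr //.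
  by rewrite replace_rowC // [in X in replace_row A j X]Aij replace_row_id.
apply: (wa i j) => //; rewrite !row_replace_row.
by rewrite ![_ == k]eq_sym (negPf ki) (negPf kj).
Qed.

End derivation_of_forms.

Section charts.
Context (R : realType).

Lemma diff_in_comp (l m n : nat) (X Y : topologicalType) (a : chart R l X)
    (c : chart R m Y) (d : chart R n Y) (f : X -> Y) x :
  (\forall y \near a x, chart_dom c (f (chart_inv a y))) ->
  chart_dom a x -> 
  differentiable (local_rep a c f) (a x) ->
  differentiable (local_rep a d f) (a x) ->
  differentiable (local_rep c d idfun) (c (f x)) ->
  diff_in a d f x = diff_in a c f x *m diff_in c d idfun (f x).
Proof.
move=> fc ax dac dad dcd; apply/row_matrixP => i.
rewrite row_mul !row_jacobian //.
rewrite (near_eq_derive (g := local_rep c d idfun \o local_rep a c f)).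
  have acE : local_rep a c f (a x) = c (f x) by rewrite /local_rep chart_mapK.
  rewrite -acE in dcd.
  have [_ ->] := is_derive_chain (basis_vec R i) dac dcd.
  by rewrite acE in dcd *; rewrite deriveEjacobian.
by apply: filterS fc => y yc; rewrite /= /local_rep chart_mapK.
Qed.

End charts.


Section submanifolds.
Context (R : realType) (n p : nat) (X : calibrated_manifold R n p).
Context (M : oriented_submanifold X).
Implicit Types (a : chart R p M) (c d : chart R n X) (m : M).

Let incl (m : M) : X := set_val m.

Definition chart_overlap a c : set 'rV[R]_p :=
  a @` (chart_dom a `&` incl @^-1` chart_dom c).

(** Openness uses that [M] carries the subspace topology, so that the inclusion
    is continuous. *)
Lemma chart_overlap_open a c : open (chart_overlap a c).
Proof.
rewrite openE => y [m [am cm] <-{y}].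
have ia : (a @` chart_dom a) (a m) by exists m.
have ci : {for a m, continuous (chart_inv a)}.
  have := chart_inv_continuous (c := a).
  by rewrite continuous_open_subspace; [apply; rewrite inE|exact: chart_img_open].
have inclc : continuous incl by exact: initial_continuous.
have H1 : \forall y \near a m, (a @` chart_dom a) y.
  by apply: open_nbhs_nbhs; split => //; exact: chart_img_open.
have H2 : \forall y \near a m, chart_dom c (incl (chart_inv a y)).
  have := continuous_comp ci (inclc (chart_inv a (a m))).
  apply; apply: open_nbhs_nbhs; split; first exact: chart_dom_open.
  by rewrite /= chart_mapK.
apply: filterS2 H1 H2 => y [m' am' <-]; rewrite chart_mapK // => cm'.
by exists m'.
Qed.

(** The induced metric is defined through one preferred chart of [X] at each
    point; to differentiate it, one chart has to be used in a whole
    neighbourhood. *)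
Lemma induced_metricE a c m : sub_atlas M a -> atlas X c ->
  chart_dom a m -> chart_dom c (incl m) ->
  induced_metric a m =
  tangent_frame a c m *m metric X c (incl m) *m (tangent_frame a c m)^T.
Proof.
move=> Ma Xc am cm; rewrite /induced_metric /=.
have Xd : atlas X (chart_at (atlas X) (incl m)) := s2valP (cid2 (charts_cover _ _)).
have dm : chart_dom (chart_at (atlas X) (incl m)) (incl m) :=
  s2valP' (cid2 (charts_cover _ _)).
set d := chart_at _ _ in Xd dm *.
have smd b : atlas X b -> chart_dom b (incl m) ->
    differentiable (local_rep a b incl) (a m).
  move=> Xb bm; have [+ _] := sub_smooth Ma Xb 1; apply.
  by exists m.
rewrite {1 2}/tangent_frame (@diff_in_comp _ _ _ _ _ _ a c d incl m) //.
- rewrite [X in _ = _ *m X *m _](metric_change (metric_riemannian X) Xc Xd) //.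
  by rewrite trmx_mul !mulmxA.
- have nS : \forall y \near a m, chart_overlap a c y.
    by apply: open_nbhs_nbhs; split; [exact: chart_overlap_open|exists m].
  by apply: filterS nS => y [m' [am' cm'] <-]; rewrite chart_mapK.
- exact: smd.
- exact: smd.
- have [+ _] := charts_compatible Xc Xd 1; apply.
  by exists (incl m).
Qed.

End submanifolds.

(** * Phi-submanifolds and the theorem *)

Section laplacian_on_submanifolds.
Context (R : realType) (n p : nat) (p0 : (0 < p)%N).
Context (X : calibrated_manifold R n p) (f : X -> R).
Hypothesis f_smooth : smooth_function (atlas X) f.

Lemma phi_hessianE (c : chart R n X) (x : X) E :
  atlas X c -> chart_dom c x ->
  let g := metric_in (metric X) c in
  let Y := gradient g (f \o chart_inv c) in
  differentiable Y (c x) ->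
  phi_hessian f c x E = derivation_form (calibration X c x)
    (jacobian Y (c x) + connection_mx g (c x) (Y (c x))) E.
Proof.
move=> Xc cx g Y Yd; apply: eq_bigr => i _; congr (calibration X c x _).
congr (replace_row E i _); rewrite covariant_derivativeE.
  by rewrite mulmxDr -deriveEjacobian.
have nO : \forall z \near c x, (c @` chart_dom c) z.
  by apply: open_nbhs_nbhs; split; [exact: chart_img_open|exists x].
apply: filterS nO => _ [x' cx' <-]; rewrite /g /metric_in chart_mapK //.
exact: (Defs.metric_sym (metric_riemannian X)).
Qed.

Lemma metric_posdef_at (c : chart R n X) x : atlas X c -> chart_dom c x ->
  posdef (metric X c x).
Proof.
move=> Xc cx; split; first exact: (Defs.metric_sym (metric_riemannian X)).
exact: (metric_posdef (metric_riemannian X)).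
Qed.

Context (M : oriented_submanifold X).
Hypothesis M_phi : phi_submanifold M.

Lemma wedge_norm_neq0 (a : chart R p M) (c : chart R n X) (m : M) :
  sub_atlas M a -> atlas X c -> chart_dom a m -> chart_dom c (set_val m) ->
  wedge_norm (metric X c (set_val m)) (tangent_frame a c m) != 0.
Proof.
move=> Ma Xc am cm; rewrite sqrtr_eq0 -ltNge; apply/posdef_det_gt0/posdef_gram.
  exact: metric_posdef_at.
exact: sub_immersion.
Qed.

Lemma unit_tangent_wedge (a : chart R p M) (c : chart R n X) (m : M) E :
  sub_atlas M a -> atlas X c -> chart_dom a m -> chart_dom c (set_val m) ->
  wedge E = unit_tangent a c m ->
  wedge (tangent_frame a c m) =
  (fun I => wedge_norm (metric X c (set_val m)) (tangent_frame a c m) * wedge E I).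
Proof.
move=> Ma Xc am cm ->; apply/funext => I; rewrite /unit_tangent mulrA.
by rewrite mulfV ?mul1r // wedge_norm_neq0.
Qed.

(** In the coordinate frame of [M] this is [laplacian_calibration].  The
    phi-Hessian is multilinear and alternating, so its values on the coordinate
    frame and on the orthonormal frame [E] differ by the volume of the coordinate
    frame, which is also the factor of the Laplacian in [laplacian_calibration]. *)
Lemma laplacian_phi_hessian (a : chart R p M) (c : chart R n X) (m : M) E :
  sub_atlas M a -> atlas X c -> chart_dom a m -> chart_dom c (set_val m) ->
  phi_frame c (set_val m) E -> wedge E = unit_tangent a c m ->
  laplacian (metric_in (@induced_metric R n p X M) a)
    ((fun m : M => f (set_val m)) \o chart_inv a) (a m) =
  phi_hessian f c (set_val m) E.
Proof.
move=> Ma Xc am cm [Eo E1] Et.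
set incl := fun m : M => set_val m : X.
set x := set_val m in cm Eo E1 *.
pose O := c @` chart_dom c; pose S := chart_overlap a c.
pose g := metric_in (metric X) c; pose w := form_in (calibration X) c.
pose u := f \o chart_inv c; pose F := local_rep a c incl.
have Xr := metric_riemannian X; have Xf := calibration_smooth X.
have wT m' : chart_dom a m' -> chart_dom c (set_val m') ->
    forall E', phi_frame c (set_val m') E' -> wedge E' = unit_tangent a c m' ->
    calibration X c (set_val m') (tangent_frame a c m') =
    wedge_norm (metric X c (set_val m')) (tangent_frame a c m').
  move=> am' cm' E' [_ E'1] /(unit_tangent_wedge Ma Xc am' cm').
  move/wedge_scale => ->; first by rewrite E'1 mulr1.
    exact: (form_multilinear Xf Xc cm').
  exact: (form_alternating Xf Xc cm').
have F_img m' : chart_dom a m' -> F (a m') = c (set_val m').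
  by move=> am'; rewrite /F /local_rep chart_mapK.
have Oimg (P : 'rV[R]_n -> Prop) :
    (forall x', chart_dom c x' -> P (c x')) -> forall z, O z -> P z.
  by move=> Pc _ [x' cx' <-]; exact: Pc.
have Simg (P : 'rV[R]_p -> Prop) :
    (forall m', chart_dom a m' -> chart_dom c (set_val m') -> P (a m')) ->
    forall y, S y -> P y.
  by move=> Pa _ [m' [am' cm'] <-]; exact: Pa.
have gE x' : chart_dom c x' -> g (c x') = metric X c x'.
  by move=> cx'; rewrite /g /metric_in chart_mapK.
have wE x' : chart_dom c x' -> w (c x') = calibration X c x'.
  by move=> cx'; rewrite /w /form_in chart_mapK.
have Oo : open O by exact: chart_img_open.
have So : open S by exact: chart_overlap_open.
have gp : forall z, O z -> posdef (g z).
  by apply: Oimg => x' cx'; rewrite gE //; exact: metric_posdef_at.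
have gd z : O z -> differentiable g z by move=> Oz; have [+ _] := metric_smooth Xr Xc 1; exact.
have wl : forall z, O z -> multilinear (w z).
  by apply: Oimg => x' cx'; rewrite wE //; exact: (form_multilinear Xf).
have wa : forall z, O z -> Defs.alternating (w z).
  by apply: Oimg => x' cx'; rewrite wE //; exact: (form_alternating Xf).
have wd z E' : O z -> differentiable (w^~ E') z.
  by move=> Oz; have [+ _] := form_smooth Xf E' Xc 1; exact.
have wc : forall z V, O z -> exterior_derivative w z V = 0.
  by move=> _ V [x' cx' <-]; exact: calibration_closed.
have w1 : forall z E', O z -> orthonormal_frame (g z) E' -> w z E' <= 1.
  by move=> _ E' [x' cx' <-]; rewrite gE // wE //; exact: calibration_le1.
have ud z : O z -> differentiable u z by move=> Oz; have [+ _] := f_smooth Xc 1; exact.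
have udd z v : O z -> differentiable (fun y => 'D_v u y) z.
  by move=> Oz; have [_ /(_ v)[+ _]] := f_smooth Xc 2; exact.
have FSO : forall y, S y -> O (F y).
  by apply: Simg => m' am' cm'; rewrite F_img //; exists (set_val m').
have Fd y : S y -> differentiable F y.
  by move=> Sy; have [+ _] := sub_smooth Ma Xc 1; exact.
have Fdd y v : S y -> differentiable (fun z => 'D_v F z) y.
  by move=> Sy; have [_ /(_ v)[+ _]] := sub_smooth Ma Xc 2; exact.
have Fc y v v' : S y -> {for y, continuous (fun z => 'D_v' (fun z => 'D_v F z) z)}.
  by move=> Sy; have [_ /(_ v)[_ /(_ v')]] := sub_smooth Ma Xc 2; exact.
have T_free : forall y, S y -> row_free (jacobian F y).
  by apply: Simg => m' am' cm'; exact: (sub_immersion Ma Xc).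
have W_gram : forall y, S y -> w (F y) (jacobian F y) ^+ 2 =
    \det (jacobian F y *m g (F y) *m (jacobian F y)^T).
  apply: Simg => m' am' cm'; have [E' E'f /(wT m' am' cm' E' E'f)] := M_phi Ma Xc am' cm'.
  rewrite F_img // gE // wE // -/(tangent_frame a c m') => ->.
  rewrite sqr_sqrtr // ltW //; apply/posdef_det_gt0/posdef_gram.
    exact: metric_posdef_at.
  exact: sub_immersion.
have hE : forall y, S y -> metric_in (@induced_metric R n p X M) a y =
    jacobian F y *m g (F y) *m (jacobian F y)^T.
  move=> _ [m' [am' cm'] <-]; rewrite (F_img m' am') (gE _ cm') /metric_in.
  by rewrite (chart_mapK am') (induced_metricE Ma Xc am' cm').
have qE : forall y, S y -> ((fun m : M => f (set_val m)) \o chart_inv a) y = u (F y).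
  by apply: Simg => m' am' cm'; rewrite F_img // /u /= !chart_mapK.
have Sm : S (a m) by exists m.
have Ox : O (c x) by exists x.
have := laplacian_calibration p0 Oo So gd gp wl wa wd wc w1 ud udd FSO Fd Fdd Fc
  T_free W_gram hE qE Sm.
rewrite F_img // wE // -/(tangent_frame a c m) -/x.
have nO : \forall z \near c x, O z by exact: open_nbhs_nbhs.
have gs : \forall z \near c x, (g z)^T = g z.
  by apply: filterS nO => z /gp[].
have Yd : differentiable (gradient g u) (c x).
  apply: gradient_differentiable; [|exact: gd|by move=> v; exact: udd].
  by apply: filterS nO => z /gp; exact: posdef_unit.
rewrite (wT m am cm E (conj Eo E1) Et) phi_hessianE // => main.
apply: (mulfI (wedge_norm_neq0 Ma Xc am cm)); rewrite {}main.
have wlx := form_multilinear Xf Xc cm; have wax := form_alternating Xf Xc cm.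
rewrite -(wedge_scale (derivation_form_multilinear _ wlx)
  (derivation_form_alternating _ wlx wax) (unit_tangent_wedge Ma Xc am cm Et)).
apply: eq_bigr => i _; congr (calibration X c x (replace_row _ i _)).
by rewrite covariant_derivativeE // mulmxDr -deriveEjacobian.
Qed.

End laplacian_on_submanifolds.

Theorem theorem1p4 (R : realType) (n p : nat) (p_gt0 : (0 < p)%N)
    (X : calibrated_manifold R n p) (f : X -> R)
    (f_smooth : smooth_function (atlas X) f) :
  (phi_plurisubharmonic f ->
     forall M : oriented_submanifold X, phi_submanifold M ->
       subharmonic_on M f) /\
  (integrable_calibration X ->
     (forall M : oriented_submanifold X, phi_submanifold M ->
        subharmonic_on M f) ->
     phi_plurisubharmonic f).
Proof.
split=> [f_psh M Mphi a m Ma am|Xint f_sh c x E Xc cx Eframe].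
  have [c Xc cm] := charts_cover (atlas X) (set_val m).
  have [E Eframe Et] := Mphi a c m Ma Xc am cm.
  by rewrite (laplacian_phi_hessian p_gt0 f_smooth Mphi Ma Xc am cm Eframe Et) f_psh.
have [|M [a [m [Mphi Ma am mx Et]]]] := Xint c x (wedge E) Xc cx.
  by exists E.
subst x; rewrite -(laplacian_phi_hessian p_gt0 f_smooth Mphi Ma Xc am cx Eframe (esym Et)).
exact: f_sh.
Qed.
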